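(* (Interlacing property.) Let $F_1(s,m)$ and $F_4(s,m)$ denote the limiting (edge scaling limit) distribution functions of the $m$-th largest eigenvalue in the Gaussian Orthogonal Ensemble and the Gaussian Symplectic Ensemble respectively, as defined in the context. Then for every $s\in\mathbb R$ and every integer $m\ge 1$, $$F_4(s,m)=F_1(s,2m).$$
   Context: Edge scaling limits. GOE: let $\ell_1\ge\ell_2\ge\dots\ge\ell_N$ be the ordered values of a random vector in $\mathbb R^N$ with density proportional to $\exp\left[-\tfrac12\sum_{j=1}^N \ell_j^2\right]\prod_{j<k}|\ell_j-\ell_k|$. Then $$F_1(s,m)=\lim_{N\to\infty}\mathrm P\left(\ell_m\le \sqrt{2N}+\frac{s}{\sqrt2\,N^{1/6}}\right).$$ GSE: let $\ell_1\ge\dots\ge\ell_n$ be the ordered values of a random vector in $\mathbb R^n$ with density proportional to $\exp\left[-\sum_{j=1}^n \ell_j^2\right]\prod_{j<k}|\ell_j-\ell_k|^4$. With $N=2n+1$, $$F_4(s,m)=\lim_{n\to\infty}\mathrm P\left(\ell_m\le \sqrt{2N}+\frac{s}{\sqrt2\,N^{1/6}}\right).$$ *)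

(* Defs.v *)
From HB Require Import structures.
From mathcomp Require Import all_boot all_order all_algebra.
From mathcomp Require Import all_classical all_reals all_analysis.

Set Implicit Arguments.
Unset Strict Implicit.
Unset Printing Implicit Defensive.

Import Order.TTheory GRing.Theory Num.Theory.
Import numFieldNormedType.Exports.

Local Open Scope classical_set_scope.
Local Open Scope ring_scope.

Section lebesgue_cons.
Local Open Scope ereal_scope.
Context (R : realType) (n : nat).
Let T := measurableTypeR R.
Variable m : {sigma_finite_measure set (n.-tuple T) -> \bar R}.

Let consT (p : T * n.-tuple T) : n.+1.-tuple T := [tuple of p.1 :: p.2].

Let measurable_consT : measurable_fun setT consT.
Proof. exact: measurable_cons. Qed.

Definition lebesgue_cons : set (n.+1.-tuple T) -> \bar R :=
  pushforward ((@lebesgue_measure R) \x m) consT.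

Let lebesgue_cons0 : lebesgue_cons set0 = 0.
Proof. by rewrite /lebesgue_cons /pushforward preimage_set0 measure0. Qed.

Let lebesgue_cons_ge0 A : 0 <= lebesgue_cons A.
Proof. exact: measure_ge0. Qed.

Let lebesgue_cons_sigma_additive : semi_sigma_additive lebesgue_cons.
Proof.
move=> F mF tF mUF; rewrite /lebesgue_cons /pushforward preimage_bigcup.
apply: measure_semi_sigma_additive.
- by move=> i; rewrite -[X in measurable X]setTI; exact: measurable_consT.
- apply/trivIsetP => i j _ _ ij; rewrite -preimage_setI.
  by move/trivIsetP : tF => -> //; rewrite preimage_set0.
- by rewrite -preimage_bigcup -[X in measurable X]setTI; exact: measurable_consT.
Qed.

HB.instance Definition _ := isMeasure.Build _ _ _ lebesgue_cons
  lebesgue_cons0 lebesgue_cons_ge0 lebesgue_cons_sigma_additive.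

Let lebesgue_cons_sigma_finite : sigma_finite setT lebesgue_cons.
Proof.
have /sigma_finiteP[F [FT ndF Foo]] := sigma_finiteT (@lebesgue_measure R).
have /sigma_finiteP[G [GT ndG Goo]] := sigma_finiteT m.
pose u (t : n.+1.-tuple T) : T * n.-tuple T := (thead t, [tuple of behead t]).
have mu : measurable_fun setT u.
  apply/measurable_fun_pair; last exact: measurable_behead.
  exact: (@measurable_tnth _ T n.+1 ord0).
have uK p : u (consT p) = p by case: p => x t; congr pair => //; apply/val_inj.
exists (fun i => u @^-1` (F i `*` G i)).
  apply/esym; rewrite -subTset => t _.
  have [i _ Fi] : (\bigcup_i F i) (u t).1 by rewrite -FT.
  have [j _ Gj] : (\bigcup_i G i) (u t).2 by rewrite -GT.
  exists (maxn i j) => //; split.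
  - by move: Fi; exact/subsetPset/ndF/leq_maxl.
  - by move: Gj; exact/subsetPset/ndG/leq_maxr.
move=> i; have [? ?] := Foo i; have [? ?] := Goo i.
have mFG : measurable (F i `*` G i) by exact: measurableX.
split; first by rewrite -[X in measurable X]setTI; exact: mu.
rewrite /lebesgue_cons /pushforward (_ : _ @^-1` _ = F i `*` G i); last first.
  by apply/seteqP; split=> p; rewrite /preimage/mkset uK.
by rewrite product_measure1E// lte_mul_pinfty// ge0_fin_numE.
Qed.

HB.instance Definition _ := Measure_isSigmaFinite.Build _ _ _ lebesgue_cons
  lebesgue_cons_sigma_finite.

End lebesgue_cons.

(* Lebesgue measure on R^n, built one coordinate at a time. *)
Fixpoint lebesgue_tuple (R : realType) (n : nat) :
    {sigma_finite_measure set (n.-tuple (measurableTypeR R)) -> \bar R} :=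
  if n is n'.+1 then lebesgue_cons (lebesgue_tuple R n')
  else \d_([tuple] : 0.-tuple (measurableTypeR R)).

Lemma lebesgue_tuple_box (R : realType) (n : nat)
    (A : 'I_n -> set (measurableTypeR R)) :
  (forall i, measurable (A i)) ->
  lebesgue_tuple R n [set t | forall i, A i (tnth t i)] =
  (\prod_(i < n) lebesgue_measure (A i))%E.
Proof.
elim: n A => [|n IH] A mA.
  by rewrite big_ord0 /= diracE mem_set// => -[].
rewrite big_ord_recl -IH//= /lebesgue_cons /pushforward.
rewrite -product_measure1E//; last first.
  rewrite (_ : [set _ | _] = \bigcap_(i in [set: 'I_n])
      ((fun t : n.-tuple _ => tnth t i) @^-1` A (lift ord0 i))).
    apply: fin_bigcap_measurable => // i _.
    by rewrite -[X in measurable X]setTI; exact: measurable_tnth.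
  by apply/seteqP; split=> t /= tA i; [move=> _|]; exact: tA.
congr (_ _); apply/seteqP; split=> -[x t] /=.
  move=> xtA; split; first exact: xtA ord0.
  by move=> i; have := xtA (lift ord0 i); rewrite tnthS.
move=> [x0 tA] i; have [->//|i0] := eqVneq i ord0.
by case: (unliftP ord0 i) i0 => [j ->|->]; rewrite ?eqxx// tnthS.
Qed.

Section beta_ensembles.
Context (R : realType).

Definition vandermonde_abs (n : nat) (x : n.-tuple R) : R :=
  \prod_(j < n) \prod_(k < n | (j < k)%N) `|tnth x j - tnth x k|.

Definition goe_weight (n : nat) (x : n.-tuple R) : R :=
  expR (- (2^-1 * \sum_(j < n) tnth x j ^+ 2)) * vandermonde_abs x.

Definition gse_weight (n : nat) (x : n.-tuple R) : R :=
  expR (- \sum_(j < n) tnth x j ^+ 2) * vandermonde_abs x ^+ 4.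

(* Probability of A under the law on R^n whose density is proportional to w. *)
Definition density_prob (n : nat) (w : n.-tuple R -> R)
    (A : set (n.-tuple (measurableTypeR R))) : R :=
  fine (\int[lebesgue_tuple R n]_(x in A) (w x)%:E) /
  fine (\int[lebesgue_tuple R n]_(x in setT) (w x)%:E).

(* The m-th largest entry of x, counted with multiplicity from m = 1;
   meaningful only for 1 <= m <= n. *)
Definition mth_largest (n : nat) (x : n.-tuple R) (m : nat) : R :=
  nth 0 (sort >=%O x) m.-1.

Definition edge (N : nat) (s : R) : R :=
  Num.sqrt (2 * N%:R) + s / (Num.sqrt 2 * N%:R `^ 6^-1).

Definition goe_edge_prob (s : R) (m N : nat) : R :=
  density_prob (@goe_weight N) [set x | mth_largest x m <= edge N s].

(* The GSE of n eigenvalues is scaled with N = 2n + 1. *)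
Definition gse_edge_prob (s : R) (m n : nat) : R :=
  density_prob (@gse_weight n) [set x | mth_largest x m <= edge n.*2.+1 s].

(* F (s, m) is the edge scaling limit F_1 (s, m), resp. F_4 (s, m), for all
   real s and m >= 1.  Stated as convergence, so that the existence of the limit
   is part of F being that function; the value at m = 0 is irrelevant. *)
Definition is_F1 (F : R -> nat -> R) : Prop :=
  forall (s : R) (m : nat), (0 < m)%N ->
    goe_edge_prob s m N @[N --> \oo] --> F s m.

Definition is_F4 (F : R -> nat -> R) : Prop :=
  forall (s : R) (m : nat), (0 < m)%N ->
    gse_edge_prob s m n @[n --> \oo] --> F s m.

End beta_ensembles.

(* Main.v *)
(* For N = 2n + 1 the even-ranked eigenvalues of GOE_N are distributed exactly as
   the ordered eigenvalues of GSE_n; the limits then coincide along N = 2n + 1.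

   Restrict the GOE weight to the chamber x_0 > y_0 > x_1 > ... > y_(n-1) > x_n and
   integrate out the x_i for fixed y.  There the weight is, up to a constant sign,
   det(phi_k(z_i)) for the functions phi_0 = w and phi_(k+1) = (x^k w)', with
   w = exp(-x^2/2), since phi_k / w has degree exactly k.  Integrating the row of each
   x_i over its gap turns all entries but those of column 0 into differences of the
   boundary values y_i^k w(y_i).  Telescoping the rows and expanding along the one that
   becomes (int w, 0, ..., 0) leaves the determinant with rows y_i^k w(y_i) and
   (y_i^k w(y_i))', a confluent Vandermonde determinant equal in absolute value to
   prod w(y_i)^2 prod |y_i - y_j|^4, which is the GSE weight. *)
Require Import Defs.
From HB Require Import structures.
From mathcomp Require Import all_boot all_order all_algebra all_fingroup.
From mathcomp Require Import all_classical all_reals all_analysis measurable_realfun.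
From mathcomp Require Import ring lra zify.

Set Implicit Arguments.
Unset Strict Implicit.
Unset Printing Implicit Defensive.

Import Order.TTheory GRing.Theory Num.Theory.
Import numFieldNormedType.Exports.

Local Open Scope classical_set_scope.
Local Open Scope ring_scope.

(** * Vandermonde determinants *)

Lemma det_poly_vandermonde (R : comNzRingType) n (p : 'I_n -> {poly R}) (x : 'I_n -> R) :
  (forall k : 'I_n, (size (p k) <= k.+1)%N) ->
  \det (\matrix_(i, k) (p k).[x i]) =
  (\prod_(k < n) (p k)`_k) * \prod_(i < n) \prod_(j < n | (i < j)%N) (x j - x i).
Proof.
move=> sp.
have -> : \matrix_(i, k) (p k).[x i] =
    (Vandermonde n (\row_i x i))^T *m \matrix_(l, k) (p k)`_l.
  apply/matrixP => i k; rewrite !mxE.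
  rewrite (horner_coef_wide (n := n)); last by apply: leq_trans (sp k) _.
  by apply: eq_bigr => l _; rewrite !mxE mulrC.
rewrite det_mulmx det_tr det_Vandermonde mulrC; congr (_ * _); last first.
  by apply: eq_bigr => i _; apply: eq_bigr => j _; rewrite !mxE.
rewrite -det_tr det_trig; first by apply: eq_bigr => k _; rewrite !mxE.
apply/is_trig_mxP => i j ij; rewrite !mxE nth_default//.
exact: leq_trans (sp i) _.
Qed.

Section confluent.
Variables (R : idomainType) (n : nat) (y : 'I_n -> R).

(** Split each double node: take the ordinary Vandermonde determinant at the 2n nodes y_i + X and
    y_i over [{poly R}], cancel the factor X^n coming from row differences, and set X = 0. The upper
    rows are the derivatives of y^k; at k = 0 the multiplicity 0 makes the truncated exponent
    harmless. *)
Lemma det_confluent_vandermonde :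
  \det (col_mx (\matrix_(i < n, k < n + n) (y i ^+ k.-1 *+ k))
               (\matrix_(i < n, k < n + n) (y i ^+ k))) =
  (-1) ^+ n * (\prod_(i < n) \prod_(j < n | (i < j)%N) (y j - y i)) ^+ 2 *
  \prod_(i < n) \prod_(j < n | j != i) (y j - y i).
Proof.
pose a (i : 'I_(n + n)) : {poly R} :=
  match fintype.split i with inl i => (y i)%:P + 'X | inr i => (y i)%:P end.
have al i : a (lshift n i) = (y i)%:P + 'X by rewrite /a (unsplitK (inl i)).
have ar i : a (rshift n i) = (y i)%:P by rewrite /a (unsplitK (inr i)).
(* The rows [y i ^+ k] and [((y i + X) ^+ k - y i ^+ k) / X]; the latter
   specialise at [X = 0] to the differentiated rows. *)
pose E : 'M[{poly R}]_(n, n + n) := \matrix_(i, k)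
  \sum_(j < k) ((y i)%:P + 'X) ^+ (k.-1 - j) * (y i)%:P ^+ j.
pose Y : 'M[{poly R}]_(n, n + n) := \matrix_(i, k) (y i)%:P ^+ k.
(* Each row of y_i + X is X times a row of [E] plus a row of [Y], so the left factor contributes
   determinant X^n. *)
have VE : (Vandermonde (n + n) (\row_i a i))^T =
    block_mx 'X%:M 1%:M 0 1%:M *m col_mx E Y.
  rewrite mul_block_col !mul_scalar_mx mul0mx add0r !scale1r.
  apply/matrixP => i k; rewrite !mxE.
  case: splitP => i' ii'; rewrite !mxE.
    have -> : i = lshift n i' by apply/val_inj.
    have := subrXX ((y i')%:P + 'X) (y i')%:P k.
    by rewrite [X in _ = X * _]addrAC subrr add0r al => <-; rewrite subrK.
  have -> : i = rshift n i' by apply/val_inj.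
  by rewrite ar.
have /(congr1 determinant) := VE.
rewrite det_tr det_Vandermonde det_mulmx det_ublock det_scalar det1 mulr1.
(* Two nodes of the same kind differ by y_j - y_i, which gives the square; a mixed pair gives -X
   when the indices agree and y_j - y_i - X otherwise. *)
have -> : \prod_(i < n + n) \prod_(j < n + n | (i < j)%N)
      ((\row_i a i) 0 j - (\row_i a i) 0 i) =
    'X ^+ n * ((-1) ^+ n *
      (\prod_(i < n) \prod_(j < n | (i < j)%N) ((y j)%:P - (y i)%:P)) ^+ 2 *
      \prod_(i < n) \prod_(j < n | j != i) ((y j)%:P - (y i)%:P - 'X)).
  rewrite big_split_ord /=.
  have -> : \prod_(i < n) \prod_(j < n + n | (lshift n i < j)%N)
      ((\row_i a i) 0 j - (\row_i a i) 0 (lshift n i)) =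
    \prod_(i < n) ((\prod_(j < n | (i < j)%N) ((y j)%:P - (y i)%:P)) *
      (- 'X * \prod_(j < n | j != i) ((y j)%:P - (y i)%:P - 'X))).
    apply: eq_bigr => i _; rewrite big_split_ord /=; congr (_ * _).
      by apply: eq_bigr => j _; rewrite !mxE !al; ring.
    rewrite (eq_bigl xpredT); last by move=> j /=; rewrite ltn_addr.
    rewrite (bigD1 i)//=; congr (_ * _); first by rewrite !mxE al ar; ring.
    by apply: eq_bigr => j _; rewrite !mxE al ar; ring.
  have -> : \prod_(i < n) \prod_(j < n + n | (rshift n i < j)%N)
      ((\row_i a i) 0 j - (\row_i a i) 0 (rshift n i)) =
    \prod_(i < n) \prod_(j < n | (i < j)%N) ((y j)%:P - (y i)%:P).
    apply: eq_bigr => i _; rewrite big_split_ord /= big_pred0 ?mul1r; last first.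
      by move=> j; apply/negP; have := ltn_ord j; lia.
    rewrite (eq_bigl (fun j : 'I_n => (i < j)%N)); last by move=> j /=; rewrite ltn_add2l.
    by apply: eq_bigr => j _; rewrite !mxE !ar.
  have -> : 'X^n = \prod_(i < n) (- 'X) * (-1) ^+ n :> {poly R}.
    rewrite prodr_const card_ord [X in _ = X * _]exprNn mulrAC -exprMn.
    by rewrite mulrNN mulr1 expr1n mul1r.
  have sgn2 : (-1) ^+ n * (-1) ^+ n = 1 :> {poly R} by rewrite -exprMn mulrNN mulr1 expr1n.
  rewrite !big_split /=.
  set P := \prod_(i < n) - 'X; set A := \prod_(i < n) \prod_(j < n | (i < j)%N) _.
  set B := \prod_(i < n) \prod_(j < n | j != i) _.
  transitivity ((-1) ^+ n * (-1) ^+ n * (P * A ^+ 2 * B)); last by ring.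
  by rewrite sgn2; ring.
move/(mulfI (expf_neq0 n (negbT (polyX_eq0 _)))).
move=> /(congr1 (horner_eval 0)); rewrite -det_map_mx map_col_mx.
have -> : map_mx (horner_eval 0) E = \matrix_(i < n, k < n + n) (y i ^+ k.-1 *+ k).
  apply/matrixP => i k; rewrite !mxE rmorph_sum /=.
  rewrite (eq_bigr (fun=> y i ^+ k.-1)); first by rewrite sumr_const card_ord.
  move=> j _; rewrite rmorphM !rmorphXn rmorphD /= /horner_eval !hornerE -exprD.
  by congr (_ ^+ _); have := ltn_ord j; lia.
have -> : map_mx (horner_eval 0) Y = \matrix_(i < n, k < n + n) (y i ^+ k).
  by apply/matrixP => i k; rewrite !mxE rmorphXn /= /horner_eval hornerC.
move=> <-; rewrite !rmorphM !rmorphXn !rmorph_prod rmorphN1; congr (_ * _ ^+ 2 * _).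
  apply: eq_bigr => i _; rewrite rmorph_prod; apply: eq_bigr => j _.
  by rewrite rmorphB /= /horner_eval !hornerC.
apply: eq_bigr => i _; rewrite rmorph_prod; apply: eq_bigr => j _.
by rewrite !rmorphB /= /horner_eval !hornerE subr0.
Qed.

End confluent.

(** Telescoping is left multiplication by a block triangular matrix with unit diagonal. The
    condition on [H n] lets the last row fit the same pattern of differences. *)
Lemma det_telescope (R : comNzRingType) n (H0 : 'rV[R]_(1 + (n + n)))
    (HV : 'M[R]_(n, 1 + (n + n))) (H : nat -> 'I_(1 + (n + n)) -> R) :
  (forall k, H n k = 0) ->
  \det (col_mx (\row_k (H0 0 k - H 0 k))
       (col_mx HV (\matrix_(i < n, k < 1 + (n + n)) (H i k - H i.+1 k)))) =
  \det (col_mx H0 (col_mx HV (\matrix_(i < n, k < 1 + (n + n)) H i k))).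
Proof.
move=> Hn0; set HU := \matrix_(i < n, k < 1 + (n + n)) H i k.
(* [F] selects row 0 of [H]. For n = 0 it is empty, in agreement with [H 0] being zero then. *)
pose F : 'rV[R]_n := \row_j (j == 0 :> nat)%:R.
pose S : 'M[R]_n := \matrix_(i, j) ((i == j)%:R - (j == i.+1 :> nat)%:R).
have FE m k : (m <= n)%N -> \sum_(j < n) (j == m :> nat)%:R * H j k = H m k.
  rewrite leq_eqVlt => /predU1P[->|mn].
    by rewrite Hn0 big1// => j _; rewrite ltn_eqF ?mul0r.
  rewrite (bigD1 (Ordinal mn))//= eqxx mul1r big1 ?addr0// => j.
  by rewrite -val_eqE /= => /negPf ->; rewrite mul0r.
have -> : col_mx (\row_k (H0 0 k - H 0 k))
       (col_mx HV (\matrix_(i < n, k < 1 + (n + n)) (H i k - H i.+1 k))) =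
    block_mx 1%:M (row_mx 0 (- F)) 0 (block_mx 1%:M 0 0 S) *m
    col_mx H0 (col_mx HV HU).
  rewrite !mul_block_col !mul1mx !mul0mx mul_row_col mul0mx mulNmx !add0r addr0.
  congr col_mx.
    apply/rowP => k; rewrite !mxE; congr (_ - _); rewrite -FE//.
    by apply: eq_bigr => j _; rewrite !mxE.
  congr col_mx; apply/matrixP => i k; rewrite !mxE.
  under eq_bigr do rewrite !mxE mulrBl.
  rewrite sumrB FE//; congr (_ - _); rewrite -[LHS](FE i k (ltnW (ltn_ord i))).
  by apply: eq_bigr => j _; rewrite -val_eqE eq_sym.
suff detS : \det S = 1 by rewrite det_mulmx !det_ublock !det1 detS !mul1r.
rewrite -det_tr det_trig.
  by rewrite big1// => i _; rewrite !mxE eqxx (ltn_eqF (ltnSn i)) subr0.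
apply/is_trig_mxP => i j ij; rewrite !mxE -val_eqE/= gtn_eqF//.
by rewrite ltn_eqF ?subrr// ltnW.
Qed.

(** Expansion along the first row leaves a 2n by 2n minor. With W = exp(-y^2/2) its rows are (y^k
    W)' and y^k W, that is, a block triangular matrix with diagonal blocks diag(W) times the
    confluent Vandermonde matrix. *)
Lemma norm_det_interlacing (R : realFieldType) n (y W : 'I_n -> R) (c : R)
    (a b : 'cV[R]_n) :
  `|\det (col_mx (row_mx c%:M 0)
      (col_mx
        (row_mx a (\matrix_(i < n, k < n + n) (W i * (y i ^+ k.-1 *+ k - y i ^+ k.+1))))
        (row_mx b (\matrix_(i < n, k < n + n) (W i * y i ^+ k))))) | =
  `|c| * (\prod_(i < n) W i ^+ 2) *
  (\prod_(i < n) \prod_(j < n | (i < j)%N) `|y i - y j|) ^+ 4.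
Proof.
rewrite -/(block_mx a _ b _) block_mxEh -/(block_mx _ _ _ _) det_lblock det_scalar1.
rewrite normrM -mulrA; congr (_ * _).
pose D := diag_mx (\row_i W i); pose D' := diag_mx (\row_i (- (W i * y i))).
have -> : col_mx
   (\matrix_(i < n, k < n + n) (W i * (y i ^+ k.-1 *+ k - y i ^+ k.+1)))
   (\matrix_(i < n, k < n + n) (W i * y i ^+ k)) =
   block_mx D D' 0 D *m
   col_mx (\matrix_(i < n, k < n + n) (y i ^+ k.-1 *+ k))
          (\matrix_(i < n, k < n + n) (y i ^+ k)).
  rewrite mul_block_col mul0mx add0r !mul_diag_mx; congr col_mx.
    by apply/matrixP => i k; rewrite !mxE exprS; ring.
  by apply/matrixP => i k; rewrite !mxE.
rewrite det_mulmx det_ublock det_diag det_confluent_vandermonde.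
under eq_bigr do rewrite mxE.
rewrite !normrM !normrX normrN1 expr1n mul1r -normrM.
set v := \prod_(i < n) \prod_(j < n | (i < j)%N) `|y i - y j|.
have -> : \prod_(i < n) W i ^+ 2 = `|(\prod_(i < n) W i) * (\prod_(i < n) W i)|.
  by rewrite -expr2 normrX real_normK ?num_real// prodrXl.
have vE : `|\prod_(i < n) \prod_(j < n | (i < j)%N) (y j - y i)| = v.
  rewrite normr_prod; apply: eq_bigr => i _; rewrite normr_prod.
  by apply: eq_bigr => j _; rewrite distrC.
(* Every unordered pair occurs here in both orders. *)
have -> : `|\prod_(i < n) \prod_(j < n | j != i) (y j - y i)| = v * v.
  rewrite normr_prod.
  transitivity (\prod_(i < n) (\prod_(j < n | (i < j)%N) `|y i - y j| *
                                \prod_(j < n | (j < i)%N) `|y i - y j|)).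
    apply: eq_bigr => i _; rewrite normr_prod (bigID (fun j : 'I_n => (i < j)%N))/=.
    congr (_ * _).
      apply: eq_big => j; first by rewrite -val_eqE/=; lia.
      by rewrite distrC.
    apply: eq_big => j; first by rewrite -val_eqE/=; lia.
    by rewrite distrC.
  rewrite big_split/=; congr (_ * _); rewrite (exchange_big_dep xpredT)//=.
  by apply: eq_bigr => i _; apply: eq_bigr => j _; rewrite distrC.
by rewrite vE !exprS expr0; ring.
Qed.

(** * Lebesgue measure on tuples *)

Section lebesgue_tuple_theory.
Context (R : realType).
Local Notation T := (measurableTypeR R).
Local Notation leb := (@lebesgue_measure R).

Definition box (n : nat) (A : 'I_n -> set T) : set (n.-tuple T) :=
  [set t | forall i, A i (tnth t i)].

Lemma measurable_box n (A : 'I_n -> set T) :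
  (forall i, measurable (A i)) -> measurable (box A).
Proof.
move=> mA; rewrite (_ : box A = \bigcap_(i in [set: 'I_n])
    ((fun t : n.-tuple _ => tnth t i) @^-1` A i)).
  apply: fin_bigcap_measurable => // i _.
  by rewrite -[X in measurable X]setTI; exact: measurable_tnth.
by apply/seteqP; split=> t /= tA i; [move=> _|]; exact: tA.
Qed.

(** A coordinate preimage, the generator of the product sigma-algebra, is a box with one nontrivial
    side. *)
Lemma measurable_tuple_box n :
  @measurable _ (n.-tuple T) =
  <<s [set box A | A in [set A | forall i, measurable (A i)]] >>.
Proof.
apply/seteqP; split.
  apply: smallest_sub; first exact: smallest_sigma_algebra.
  rewrite -bigcup_seq => B /= [i _ [C mC <-]]; rewrite setTI.
  apply: sub_sigma_algebra => /=; exists (fun j => if j == i then C else setT).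
    by move=> j; case: ifP.
  apply/seteqP; split=> t /=; first by move/(_ i); rewrite eqxx.
  by move=> Ct j; case: eqP => // ->.
apply: smallest_sub; first exact: sigma_algebra_measurable.
by move=> _ [A mA <-]; exact: measurable_box.
Qed.

(** Boxes form a generating family closed under intersection, and the cubes [-k, k]^n exhaust the
    space with finite volume. *)
Lemma lebesgue_tuple_unique n (mu : {measure set (n.-tuple T) -> \bar R}) :
  (forall A : 'I_n -> set T, (forall i, measurable (A i)) ->
    mu (box A) = (\prod_(i < n) leb (A i))%E) ->
  forall X, measurable X -> lebesgue_tuple R n X = mu X.
Proof.
move=> muE X mX.
pose K (k : nat) : set T := `[- k%:R, k%:R]%classic.
have mK k : measurable (K k) by exact: measurable_itv.
apply: (measure_unique _ (fun k => box (fun=> K k)) (measurable_tuple_box n)) => //.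
- move=> _ _ [A mA <-] [B mB <-]; exists (fun i => A i `&` B i).
    by move=> i; exact: measurableI.
  apply/seteqP; split=> t /=; first by move=> AB; split => i; have [] := AB i.
  by move=> [At Bt] i; split.
- by move=> k /=; exists (fun=> K k).
- apply/seteqP; split=> // t _.
  have [k kP] : exists k : nat, forall i, `|tnth t i| <= k%:R.
    (* The ceilings are nonnegative, so their absolute values bound the coordinates. *)
    exists (\max_(i < n) `|Num.ceil `|tnth t i| |)%N => i.
    apply: le_trans (ceil_ge _) _.
    have c0 : 0 <= Num.ceil `|tnth t i|.
      by rewrite ceil_ge0 (lt_le_trans _ (normr_ge0 _))// ltrN10.
    rewrite -[X in X%:~R](gez0_abs c0) -pmulrn ler_nat.
    exact: (leq_bigmax (F := fun i => `|Num.ceil `|tnth t i| |%N)).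
  by exists k => // i; rewrite /K/= in_itv/= -ler_norml.
- by move=> A [B mB <-]; rewrite muE//; exact: lebesgue_tuple_box.
- move=> k; rewrite [X in (X < _)%E](lebesgue_tuple_box (A := fun=> K k))//.
  have fK : leb (K k) \is a fin_num.
    by rewrite /K lebesgue_measure_itv/=; case: ifP.
  rewrite (eq_bigr (fun i : 'I_n => (fine (leb (K k)))%:E)); last first.
    by move=> i _; rewrite fineK//.
  by rewrite prodEFin ltry.
Qed.

(** Changes of variables reduce to the volumes of preimages of boxes; this serves both for permuting
    coordinates and for splitting them into two groups. *)
Lemma ge0_integral_lebesgue_tuple d (X : measurableType d)
    (mu : {measure set X -> \bar R}) n (phi : X -> n.-tuple T)
    (f : n.-tuple T -> \bar R) :
  measurable_fun setT phi ->
  (forall A : 'I_n -> set T, (forall i, measurable (A i)) ->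
    mu (phi @^-1` box A) = (\prod_(i < n) leb (A i))%E) ->
  measurable_fun [set: n.-tuple T] f -> (forall x, 0 <= f x)%E ->
  (\int[lebesgue_tuple R n]_z f z = \int[mu]_x f (phi x))%E.
Proof.
move=> mphi phiE mf f0.
pose phi' : {mfun X >-> n.-tuple T} := HB.pack phi (isMeasurableFun.Build _ _ _ _ _ mphi).
rewrite (eq_measure_integral (pushforward mu phi')); last first.
  by move=> A mA _; apply: lebesgue_tuple_unique => // B mB; rewrite -phiE.
by rewrite ge0_integral_pushforward.
Qed.

Definition permt n (s : 'S_n) (x : n.-tuple T) : n.-tuple T :=
  [tuple tnth x (s i) | i < n].

Lemma measurable_permt n (s : 'S_n) : measurable_fun setT (permt s).
Proof.
apply/measurable_fun_tnthP => i; rewrite (_ : _ \o _ = @tnth _ T ^~ (s i)).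
  exact: measurable_tnth.
by apply/funext => x /=; rewrite tnth_mktuple.
Qed.

Lemma permtM n (s p : 'S_n) x : permt s (permt p x) = permt (s * p)%g x.
Proof. by apply: eq_from_tnth => i; rewrite !tnth_mktuple permM. Qed.

Lemma perm_permt n (s : 'S_n) (x : n.-tuple T) : perm_eq (permt s x) x.
Proof. by apply/tuple_permP; exists s. Qed.

Lemma ge0_integral_permt n (s : 'S_n) (f : n.-tuple T -> \bar R) :
  measurable_fun [set: n.-tuple T] f -> (forall x, 0 <= f x)%E ->
  (\int[lebesgue_tuple R n]_x f (permt s x) = \int[lebesgue_tuple R n]_x f x)%E.
Proof.
move=> mf f0; apply: esym.
have := ge0_integral_lebesgue_tuple (mu := lebesgue_tuple R n) (measurable_permt s) _ mf f0.
apply.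
move=> A mA; rewrite (_ : _ @^-1` _ = box (fun i => A ((s^-1)%g i))).
  apply: (etrans (lebesgue_tuple_box (A := fun i => A ((s^-1)%g i)) _)) => //.
  rewrite (reindex_inj (@perm_inj _ s))/=.
  by apply: eq_bigr => i _; rewrite permK.
apply/seteqP; split=> x /= xA i.
  by have := xA ((s^-1)%g i); rewrite tnth_mktuple permKV.
by have := xA (s i); rewrite tnth_mktuple permK.
Qed.

Definition decreasing n : set (n.-tuple T) :=
  [set x | forall i j : 'I_n, (i < j)%N -> tnth x j < tnth x i].

Lemma measurable_decreasing n : measurable (@decreasing n).
Proof.
rewrite (_ : decreasing (n:=n) =
   \bigcap_(i in [set: 'I_n]) \bigcap_(j in [set j : 'I_n | (i < j)%N])
   [set x | tnth x j < tnth x i]).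
  apply: fin_bigcap_measurable => // i _; apply: fin_bigcap_measurable => // j _.
  have := measurable_fun_ltr (measurable_tnth (T := T) j) (measurable_tnth i).
  by move=> /(_ measurableT [set true]); rewrite setTI; exact.
apply/seteqP; split=> x /=; first by move=> xD i _ j /xD.
by move=> xD i j ij; exact: xD.
Qed.

Lemma decreasing_sorted n (x : n.-tuple T) : decreasing x <-> sorted >%O x.
Proof.
split=> [xD|xs i j ij].
  apply/(sortedP 0) => i; rewrite size_tuple => iN.
  have iN' := ltnW iN.
  by have := xD (Ordinal iN') (Ordinal iN) (ltnSn _); rewrite !(tnth_nth 0).
have gt_tr : transitive (>%O : rel R) by move=> a b c ba ac; exact: lt_trans ac ba.
by rewrite !(tnth_nth 0); apply: (sorted_ltn_nth gt_tr) => //; rewrite inE size_tuple.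
Qed.

Lemma sort_permt n (s : 'S_n) (x : n.-tuple T) : decreasing (permt s x) ->
  sort >=%O x = permt s x :> seq R.
Proof.
move=> /decreasing_sorted xs.
apply: (sorted_eq (leT := >=%O)).
- by move=> a b c ba ac; exact: le_trans ac ba.
- by move=> a b /andP[/= ba ab]; apply/eqP; rewrite eq_le ab ba.
- by apply: sort_sorted => a b; exact: le_total.
- by apply: sub_sorted xs => a b; exact: ltW.
- by rewrite perm_sort perm_sym perm_permt.
Qed.

Lemma decreasing_permt_ex n (x : n.-tuple T) : uniq x ->
  exists s, decreasing (permt s x).
Proof.
move=> xu; have /tuple_permP[s sE] : perm_eq (sort_tuple >=%O x) x by rewrite perm_sort.
have ge_tr : transitive (>=%O : rel R) by move=> a b c ba ac; exact: le_trans ac ba.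
have ys : sorted >=%O (permt s x).
  by rewrite /permt -sE; apply: sort_sorted => a b; exact: le_total.
exists s => i j ij; rewrite lt_neqAle; apply/andP; split.
  apply/negP => /eqP; rewrite !tnth_mktuple => /(tuple_uniqP _ xu) /perm_inj ji.
  by rewrite ji ltnn in ij.
rewrite !(tnth_nth 0).
by apply: (sorted_ltn_nth ge_tr 0 ys) => //; rewrite inE size_tuple.
Qed.

Lemma decreasing_permt_inj n (x : n.-tuple T) (s p : 'S_n) : uniq x ->
  decreasing (permt s x) -> decreasing (permt p x) -> s = p.
Proof.
move=> xu /sort_permt sE /sort_permt; rewrite sE => spE.
have /val_inj sp : permt s x = permt p x :> seq R by [].
apply/permP => i; apply: (tuple_uniqP _ xu).
by have := congr1 (fun t => tnth t i) sp; rewrite !tnth_mktuple.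
Qed.

(** Exactly one permutation puts distinct entries in decreasing order. The chambers thus give a
    partition of unity away from ties. *)
Lemma sum_decreasing_permt n (x : n.-tuple T) : uniq x ->
  \sum_(s : 'S_n) \1_(@decreasing n) (permt s x) = 1 :> R.
Proof.
move=> xu; have [s xs] := decreasing_permt_ex xu.
rewrite (bigD1 s)//= indicE mem_set// big1 ?addr0// => p ps.
rewrite indicE memNset// => xp.
by rewrite (decreasing_permt_inj xu xp xs) eqxx in ps.
Qed.

(* Any fixed reordering [p] of the decreasing chamber may be used, since the
   measure and [f] are both invariant under permutations. *)
Lemma ge0_integral_symmetric n (p : 'S_n) (f : n.-tuple T -> R) :
  measurable_fun [set: n.-tuple T] f -> (forall x, 0 <= f x) ->
  (forall (s : 'S_n) x, f (permt s x) = f x) ->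
  (forall x : n.-tuple T, ~~ uniq x -> f x = 0) ->
  (\int[lebesgue_tuple R n]_x (f x)%:E =
   n`!%:R%:E * \int[lebesgue_tuple R n]_x
     (\1_(@decreasing n) (permt p x) * f x)%:E)%E.
Proof.
move=> mf f0 fS fU.
pose g (x : n.-tuple T) : R := \1_(@decreasing n) (permt p x) * f x.
have mg : measurable_fun setT (fun x : n.-tuple T => (g x)%:E).
  apply/measurable_EFinP/measurable_funM => //.
  have mD : measurable_fun [set: n.-tuple T] (\1_(@decreasing n) : _ -> R).
    by apply: measurable_indic; exact: measurable_decreasing.
  exact: (measurableT_comp mD (measurable_permt p)).
have g0 (x : n.-tuple T) : (0 <= (g x)%:E)%E by rewrite lee_fin mulr_ge0.
(* Translating the summation index by the inverse of [p] removes [p]; at a tie both sides vanish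
   because f does. *)
have fE (x : n.-tuple T) : f x = \sum_(s : 'S_n) g (permt s x).
  rewrite (reindex_inj (@mulgI _ (p^-1)%g))/=.
  under eq_bigr do rewrite /g permtM mulgA mulgV mul1g fS.
  rewrite -mulr_suml; have [xu|/fU ->] := boolP (uniq x); last by rewrite mulr0.
  by rewrite sum_decreasing_permt// mul1r.
under eq_integral do rewrite fE -sumEFin.
rewrite ge0_integral_sum//; last first.
  by move=> s; exact: (measurableT_comp mg (measurable_permt s)).
set I := (\int[_]_x _)%E.
rewrite (eq_bigr (fun=> 1%:E * I)%E); last first.
  by move=> s _; rewrite mul1e; exact: ge0_integral_permt mg g0.
by rewrite -ge0_sume_distrl// sumEFin sumr_const card_Sn.
Qed.

End lebesgue_tuple_theory.

(** * Product integrands and the splitting of 2n + 1 coordinates *)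

Section product_integrals.
Context (R : realType).
Local Notation T := (measurableTypeR R).
Local Notation leb := (@lebesgue_measure R).

Lemma integral_prod_mul d1 d2 (T1 : measurableType d1) (T2 : measurableType d2)
    (m1 : {sigma_finite_measure set T1 -> \bar R})
    (m2 : {sigma_finite_measure set T2 -> \bar R}) (f1 : T1 -> R) (f2 : T2 -> R) :
  m1.-integrable setT (EFin \o f1) -> m2.-integrable setT (EFin \o f2) ->
  (m1 \x m2)%E.-integrable setT (fun p => (f1 p.1 * f2 p.2)%:E) /\
  (\int[(m1 \x m2)%E]_p (f1 p.1 * f2 p.2)%:E =
   (\int[m1]_x f1 x * \int[m2]_x f2 x)%R%:E)%E.
Proof.
move=> i1 i2.
have m1f : measurable_fun setT f1 by apply/measurable_EFinP; exact: measurable_int i1.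
have m2f : measurable_fun setT f2 by apply/measurable_EFinP; exact: measurable_int i2.
have mf : measurable_fun setT (fun p : T1 * T2 => (f1 p.1 * f2 p.2)%:E).
  apply/measurable_EFinP; apply: measurable_funM.
    exact: (measurableT_comp m1f measurable_fst).
  exact: (measurableT_comp m2f measurable_snd).
have i12 : (m1 \x m2)%E.-integrable setT (fun p => (f1 p.1 * f2 p.2)%:E).
  apply/(integrable12ltyP _ _ mf) => /=.
  under eq_integral do under eq_integral do rewrite normrM EFinM.
  have /integrableP[_ /= oo1] := i1; have /integrableP[_ /= oo2] := i2.
  have mabs1 : measurable_fun setT (fun x => `|f1 x|%:E).
    by apply/measurable_EFinP; exact: measurableT_comp.
  have mabs2 : measurable_fun setT (fun y => `|f2 y|%:E).
    by apply/measurable_EFinP; exact: measurableT_comp.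
  under eq_integral do rewrite ge0_integralZl//.
  rewrite ge0_integralZr//; last by rewrite integral_ge0.
  by rewrite lte_mul_pinfty// ?ge0_fin_numE// integral_ge0.
split => //; rewrite -integral12_prod_meas1// /fubini_F /=.
transitivity (\int[m1]_x ((\int[m2]_y f2 y)%R%:E * (f1 x)%:E))%E.
  apply: eq_integral => x _; under eq_integral do rewrite EFinM.
  by rewrite integralZl// muleC fineK// integrable_fin_num.
by rewrite integralZl// EFinM muleC [in RHS]fineK// integrable_fin_num.
Qed.

(** Fubini, one coordinate at a time. This is what evaluates each term of a Leibniz expansion. *)
Lemma integral_prod_tuple n (g : 'I_n -> R -> R) :
  (forall i, leb.-integrable setT (EFin \o g i)) ->
  (lebesgue_tuple R n).-integrable setT
    (fun x => (\prod_(i < n) g i (tnth x i))%:E) /\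
  (\int[lebesgue_tuple R n]_x (\prod_(i < n) g i (tnth x i))%:E =
   (\prod_(i < n) \int[leb]_u g i u)%R%:E)%E.
Proof.
elim: n g => [|n IH] g ig.
  have -> : (fun x : 0.-tuple T => (\prod_(i < 0) g i (tnth x i))%:E) = cst 1%:E.
    by apply/funext => x; rewrite big_ord0.
  split; last by rewrite integral_dirac// diracT mul1e big_ord0.
  apply/integrableP; split => //.
  by rewrite integral_dirac// diracT mul1e /= normr1 ltry.
have [iP EP] := IH (fun i => g (lift ord0 i)) (fun i => ig (lift ord0 i)).
have [i12 E12] := integral_prod_mul (ig ord0) iP.
pose consT (p : T * n.-tuple T) : n.+1.-tuple T := [tuple of p.1 :: p.2].
have mc : measurable_fun setT consT by exact: measurable_cons.
have fE p : g ord0 p.1 * \prod_(i < n) g (lift ord0 i) (tnth p.2 i) =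
    \prod_(i < n.+1) g i (tnth (consT p) i).
  rewrite big_ord_recl; congr (_ * _).
  by apply: eq_bigr => i _; rewrite tnthS.
have mg : measurable_fun setT
    (fun x : n.+1.-tuple T => (\prod_(i < n.+1) g i (tnth x i))%:E).
  apply/measurable_EFinP; apply: measurable_prod => i _.
  apply: (measurableT_comp (f := g i)); last exact: measurable_tnth.
  by apply/measurable_EFinP; exact: measurable_int (ig i).
have E x : (EFin \o (fun p => g ord0 p.1 * \prod_(i < n) g (lift ord0 i) (tnth p.2 i))) x =
   ((fun x : n.+1.-tuple T => (\prod_(i < n.+1) g i (tnth x i))%:E) \o consT) x.
  by rewrite /= fE.
have ic : (leb \x lebesgue_tuple R n)%E.-integrable (consT @^-1` setT)
    ((fun x : n.+1.-tuple T => (\prod_(i < n.+1) g i (tnth x i))%:E) \o consT).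
  by rewrite -(funext E).
split; first exact: (integrable_pushforward mc mg ic measurableT).
transitivity (\int[(leb \x lebesgue_tuple R n)%E]_p
    ((fun x : n.+1.-tuple T => (\prod_(i < n.+1) g i (tnth x i))%:E) \o consT) p)%E.
  exact: (integral_pushforward mc mg ic measurableT).
by rewrite -(funext E) E12 big_ord_recl {2}/Rintegral EP.
Qed.

(** The order x_0, y, x_1, ..., x_n is that of the rows of the block matrices indexed by
    [1 + (n + n)]. *)
Definition shuffle n (y : n.-tuple T) (x : n.+1.-tuple T) : (1 + (n + n)).-tuple T :=
  [tuple match fintype.split i with
         | inl _ => tnth x ord0
         | inr j => match fintype.split j with
                    | inl k => tnth y k
                    | inr k => tnth x (lift ord0 k)
                    end
         end | i < 1 + (n + n)].

Lemma tnth_shuffle0 n (y : n.-tuple T) x i :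
  tnth (shuffle y x) (lshift (n + n) i) = tnth x ord0.
Proof. by rewrite tnth_mktuple (unsplitK (inl i)). Qed.

Lemma tnth_shuffle1 n (y : n.-tuple T) x k :
  tnth (shuffle y x) (rshift 1 (lshift n k)) = tnth y k.
Proof. by rewrite tnth_mktuple (unsplitK (inr (lshift n k))) (unsplitK (inl k)). Qed.

Lemma tnth_shuffle2 n (y : n.-tuple T) x k :
  tnth (shuffle y x) (rshift 1 (rshift n k)) = tnth x (lift ord0 k).
Proof. by rewrite tnth_mktuple (unsplitK (inr (rshift n k))) (unsplitK (inr k)). Qed.

Lemma shuffle_indexP n (i : 'I_(1 + (n + n))) :
  [\/ i = lshift (n + n) ord0, exists k, i = rshift 1 (lshift n k) |
      exists k, i = rshift 1 (rshift n k)].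
Proof.
rewrite -(splitK i); case: (fintype.split i) => j /=.
  by apply: Or31; rewrite (ord1 j).
rewrite -(splitK j); case: (fintype.split j) => k /=.
  by apply: Or32; exists k.
by apply: Or33; exists k.
Qed.

Lemma measurable_shuffle n :
  measurable_fun setT (fun p : n.-tuple T * n.+1.-tuple T => shuffle p.1 p.2).
Proof.
apply/measurable_fun_tnthP => i.
have mt2 j : measurable_fun setT (fun p : n.-tuple T * n.+1.-tuple T => tnth p.2 j).
  exact: (measurableT_comp (measurable_tnth j) measurable_snd).
case: (shuffle_indexP i) => [->|[k ->]|[k ->]].
- rewrite (_ : _ \o _ = fun p => tnth p.2 ord0); first exact: mt2.
  by apply/funext => p; rewrite /= tnth_shuffle0.
- rewrite (_ : _ \o _ = fun p => tnth p.1 k).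
    exact: (measurableT_comp (measurable_tnth k) measurable_fst).
  by apply/funext => p; rewrite /= tnth_shuffle1.
- rewrite (_ : _ \o _ = fun p => tnth p.2 (lift ord0 k)); first exact: mt2.
  by apply/funext => p; rewrite /= tnth_shuffle2.
Qed.

(** [shuffle] only relists coordinates, so the preimage of a box is a product of two boxes; Tonelli
    then separates y from x. *)
Lemma ge0_integral_shuffle n (f : (1 + (n + n)).-tuple T -> \bar R) :
  measurable_fun [set: (1 + (n + n)).-tuple T] f -> (forall x, 0 <= f x)%E ->
  (\int[lebesgue_tuple R (1 + (n + n))]_z f z =
   \int[lebesgue_tuple R n]_y \int[lebesgue_tuple R n.+1]_x f (shuffle y x))%E.
Proof.
move=> mf f0.
have := ge0_integral_lebesgue_tuple
  (mu := (lebesgue_tuple R n \x lebesgue_tuple R n.+1)%E) (@measurable_shuffle n) _ mf f0.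
move=> -> //.
  rewrite fubini_tonelli1//.
  exact: (measurableT_comp mf (@measurable_shuffle n)).
move=> A mA.
pose A1 k := A (rshift 1 (lshift n k)).
pose A2 (i : 'I_n.+1) := if unlift ord0 i is Some k then A (rshift 1 (rshift n k))
  else A (lshift (n + n) ord0).
have mA2 i : measurable (A2 i) by rewrite /A2; case: unlift.
rewrite (_ : _ @^-1` _ = box A1 `*` box A2).
  have mA1 k : measurable (A1 k) by exact: mA.
  apply: (etrans (product_measure1E _ _ (measurable_box mA1) (measurable_box mA2))).
  transitivity ((\prod_(k < n) leb (A1 k)) * (\prod_(i < n.+1) leb (A2 i)))%E.
    by congr (_ * _)%E; exact: lebesgue_tuple_box.
  rewrite big_ord_recl [in RHS]big_split_ord big_ord1 big_split_ord /= muleCA.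
  rewrite /A2 unlift_none; congr (_ * (_ * _))%E.
  by apply: eq_bigr => i _; rewrite liftK.
apply/seteqP; split => -[y x] /=.
  move=> xyA; split => [k /=|i /=].
    by have := xyA (rshift 1 (lshift n k)); rewrite tnth_shuffle1.
  rewrite /A2; case: unliftP => [k ->|->].
    by have := xyA (rshift 1 (rshift n k)); rewrite tnth_shuffle2.
  by have := xyA (lshift (n + n) ord0); rewrite tnth_shuffle0.
move=> [yA xA] i; case: (shuffle_indexP i) => [->|[k ->]|[k ->]].
- by rewrite tnth_shuffle0; have := xA ord0; rewrite /A2 unlift_none.
- by rewrite tnth_shuffle1; exact: yA.
- by rewrite tnth_shuffle2; have := xA (lift ord0 k); rewrite /A2 liftK.
Qed.

End product_integrals.

(** * Integrals of Hermite-type functions *)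

Section ray_integrals.
Context (R : realType).
Local Notation leb := (@lebesgue_measure R).

(** Dominated convergence for the restrictions of f to [A n], with |f| as the bound. *)
Lemma cvg_Rintegral_exhaust (f : R -> R) (D : set R) (A : nat -> set R) :
  measurable D -> (forall n, measurable (A n)) -> leb.-integrable D (EFin \o f) ->
  (forall n, A n `<=` D) -> (forall x, D x -> \forall n \near \oo, A n x) ->
  \int[leb]_(x in A n) f x @[n --> \oo] --> \int[leb]_(x in D) f x.
Proof.
move=> mD mA fi AD DA.
have mf : measurable_fun D (EFin \o f) by exact: measurable_int fi.
have mfn n : measurable_fun D ((EFin \o f) \_ (A n)).
  apply/(measurable_restrict _ (mA n) mD); by apply: measurable_funS mf => // x [].
have fD : {ae leb, forall x, D x -> ((EFin \o f) \_ (A n)) x @[n --> \oo] --> (f x)%:E}.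
  apply: aeW => x Dx; apply: cvg_near_cst; apply: filterS (DA x Dx) => n Anx.
  by rewrite patchE mem_set.
have fA : {ae leb, forall x n, D x ->
    (`|((EFin \o f) \_ (A n)) x| <= (abse \o (EFin \o f)) x)%E}.
  by apply: aeW => x n Dx /=; rewrite patchE; case: ifP => // _; rewrite abse0.
have [_ _ cv] := @dominated_convergence _ _ _ leb _ mD _ _ _ mfn mf fD (integrable_abse fi) fA.
apply: (fine_cvg (f := fun n => (\int[leb]_(x in A n) (f x)%:E)%E)).
rewrite fineK ?integrable_fin_num//.
apply: cvg_trans cv; apply: near_eq_cvg; apply: nearW => n /=.
rewrite -integral_mkcondr; congr (integral _ _ _).
by rewrite setIidr.
Qed.

Variables (f F : R -> R).
Hypotheses (dF : forall x : R, is_derive x (1 : R) F (f x)) (cf : continuous f)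
  (fi : leb.-integrable setT (EFin \o f))
  (Foo : F n%:R @[n --> \oo] --> 0) (FNoo : F (- n%:R) @[n --> \oo] --> 0).

Let cF : continuous F.
Proof.
move=> x; apply: differentiable_continuous; apply/derivable1_diffP.
exact: ex_derive.
Qed.

Let FTC (a b : R) : a < b -> \int[leb]_(x in `[a, b]) f x = F b - F a.
Proof.
move=> ab; rewrite /Rintegral (continuous_FTC2 (F := F) ab)//.
- exact: continuous_subspaceT.
- split; first by move=> x _; exact: ex_derive.
  + exact/cvg_at_right_filter/cF.
  + exact/cvg_at_left_filter/cF.
- by move=> x _; rewrite derive1E; exact: derive_val.
Qed.

(** Let n tend to infinity in the formula F(b) - F(-n) for the integral over [-n, b]. *)
Lemma Rintegral_FTCNy b : \int[leb]_(x in `]-oo, b]) f x = F b.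
Proof.
have fib : leb.-integrable `]-oo, b] (EFin \o f).
  exact: integrableS fi.
have cv : \int[leb]_(x in `[- n%:R, b]) f x @[n --> \oo] -->
    \int[leb]_(x in `]-oo, b]) f x.
  apply: cvg_Rintegral_exhaust => //.
  - by move=> n x /=; rewrite !in_itv/= => /andP[].
  - move=> x /=; rewrite in_itv/= => xb.
    near=> n; rewrite in_itv/= xb andbT lerNl.
    near: n; exact: nbhs_infty_ger.
apply: (cvg_unique (@Rhausdorff R) cv).
have : F b - F (- n%:R) @[n --> \oo] --> F b - 0.
  by apply: cvgB => //; exact: cvg_cst.
rewrite subr0; apply: cvg_trans; apply: near_eq_cvg; near=> n; rewrite FTC// ltrNl.
near: n; exact: nbhs_infty_gtr.
Unshelve. all: by end_near. Qed.

Lemma Rintegral_FTCT : \int[leb]_x f x = 0.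
Proof.
have cv : \int[leb]_(x in `]-oo, n%:R]) f x @[n --> \oo] --> \int[leb]_x f x.
  apply: cvg_Rintegral_exhaust => //.
  by move=> x _ /=; near=> n; rewrite in_itv/=; near: n; exact: nbhs_infty_ger.
apply: (cvg_unique (@Rhausdorff R) cv).
apply: cvg_trans Foo; apply: near_eq_cvg; apply: nearW => n.
by rewrite Rintegral_FTCNy.
Unshelve. all: by end_near. Qed.

End ray_integrals.

Section gaussian_monomials.
Context (R : realType).
Local Notation leb := (@lebesgue_measure R).

(** The one-variable factor of the GOE weight; its square is that of the GSE weight. *)
Definition gauss_weight (x : R) : R := expR (- (2^-1 * x ^+ 2)).

Lemma gauss_weight_gt0 x : 0 < gauss_weight x.
Proof. exact: expR_gt0. Qed.

(** With u = t/(k+1), the bound u <= 1 + u <= e^u gives u^k <= e^(ku) <= e^t. Dividing by k + 1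
    instead of k includes k = 0. *)
Lemma exprn_le_expR (t : R) k : 0 <= t -> t ^+ k <= k.+1%:R ^+ k * expR t.
Proof.
move=> t0; pose u := t / k.+1%:R.
have u0 : 0 <= u by rewrite divr_ge0.
have tE : t = k.+1%:R * u by rewrite /u mulrCA divff ?mulr1// pnatr_eq0.
rewrite {1}tE exprMn ler_wpM2l ?exprn_ge0//.
apply: (@le_trans _ _ (expR u ^+ k)).
  by rewrite lerXn2r ?nnegrE ?expR_ge0// (le_trans _ (expR_ge1Dx u))// lerDr.
rewrite -expRM_natl ler_expR [leRHS]tE ler_wpM2r// ler_nat.
exact: leqnSn.
Qed.

Definition gauss_monomial k (x : R) : R := x ^+ k * gauss_weight x.

Lemma gauss_monomial_le k :
  exists C : R, forall x, `|gauss_monomial k x| <= C * expR (- (x ^+ 2 / 4)).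
Proof.
(* With t = x^2/4 the weight is e^(-t) e^(-t). One factor absorbs the power, since |x|^k <= 1 +
   x^(2k) = 1 + 4^k t^k and t^k <= (k+1)^k e^t. *)
exists (1 + 4 ^+ k * k.+1%:R ^+ k) => x; pose t := x ^+ 2 / 4.
have t0 : 0 <= t by rewrite divr_ge0// sqr_ge0.
have wE : gauss_weight x = expR (- t) * expR (- t).
  by rewrite -expRD /gauss_weight; congr expR; rewrite /t; field.
rewrite normrM (ger0_norm (ltW (gauss_weight_gt0 x))) wE mulrA.
rewrite ler_wpM2r ?expR_ge0// normrX.
apply: (@le_trans _ _ ((1 + 4 ^+ k * k.+1%:R ^+ k * expR t) * expR (- t))).
  rewrite ler_wpM2r ?expR_ge0//.
  apply: (@le_trans _ _ (1 + (`|x| ^+ k) ^+ 2)).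
    by have := sqr_ge0 (`|x| ^+ k - 2^-1); nra.
  rewrite lerD2l -exprM mulnC exprM real_normK ?num_real//.
  have -> : x ^+ 2 = 4 * t by rewrite /t mulrCA divff ?mulr1.
  by rewrite exprMn -mulrA ler_wpM2l ?exprn_ge0// exprn_le_expR.
rewrite mulrDl -!mulrA expRxMexpNx_1 mulr1 mul1r lerD2r.
by rewrite -expR0 ler_expR oppr_le0.
Qed.

Lemma continuous_gauss_weight : continuous gauss_weight.
Proof.
move=> x; apply: (continuous_comp (f := fun x : R => - (2^-1 * x ^+ 2))).
  apply: (@cvgN _ R^o); apply: cvgM; first exact: cvg_cst.
  exact: exprn_continuous.
exact: continuous_expR.
Qed.

Lemma continuous_gauss_monomial k : continuous (gauss_monomial k).
Proof.
move=> x; apply: cvgM; first exact: exprn_continuous.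
exact: continuous_gauss_weight.
Qed.

(** The bound exp(-x^2/4) is a multiple of the normal density of variance 2. *)
Lemma integrable_gauss_monomial k :
  leb.-integrable setT (EFin \o gauss_monomial k).
Proof.
have s0 : Num.sqrt 2 != 0 :> R by rewrite gt_eqF// sqrtr_gt0.
have [C HC] := gauss_monomial_le k.
have pE x : expR (- (x ^+ 2 / 4)) =
    (normal_peak (Num.sqrt 2))^-1 * normal_pdf 0 (Num.sqrt 2) x :> R.
  rewrite normal_pdfE// mulrA mulVf ?mul1r; last by rewrite gt_eqF// normal_peak_gt0.
  rewrite /normal_fun subr0 sqr_sqrtr// mulNr; congr (expR (- (_ / _))).
  by rewrite -mulr_natr; ring.
have ip : leb.-integrable setT
    (fun x => (C * (normal_peak (Num.sqrt 2))^-1)%:E *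
              (normal_pdf 0 (Num.sqrt 2) x)%:E)%E.
  exact/integrableZl/integrable_normal_pdf.
apply: le_integrable ip => //.
  apply/measurable_EFinP; apply: continuous_measurable_fun.
  exact: continuous_gauss_monomial.
move=> x _; rewrite /= lee_fin.
apply: le_trans (HC x) _; rewrite pE mulrA; exact: ler_norm.
Qed.

(** Multiplying by n turns the absolute value into that of the next monomial, which is bounded, so
    the decay is O(1/n). The signs e = 1 and e = -1 give the two ends of the line. *)
Lemma cvg_gauss_monomial k (e : R) : `|e| = 1 ->
  gauss_monomial k (e * n%:R) @[n --> \oo] --> 0.
Proof.
move=> e1; have [C HC] := gauss_monomial_le k.+1.
apply/cvgr0Pnorm_le => eps eps0; near=> n.
have nC : C / eps <= n%:R by near: n; exact: nbhs_infty_ger.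
have n0 : 0 < n%:R :> R by rewrite ltr0n; near: n; exact: nbhs_infty_gt.
rewrite -(ler_pM2r n0); apply: (@le_trans _ _ C); last first.
  by rewrite mulrC -ler_pdivrMr.
have := HC (e * n%:R).
rewrite {1}/gauss_monomial exprS -mulrA normrM normrM e1 mul1r (ger0_norm (ltW n0)) mulrC.
move=> /le_trans; apply; rewrite ler_piMr//.
  by have := HC 0; rewrite expr0n/= mul0r oppr0 expR0 mulr1; exact: le_trans.
by rewrite -expR0 ler_expR oppr_le0 divr_ge0 ?sqr_ge0.
Unshelve. all: by end_near. Qed.

(* [gauss_row 0] is the weight and [gauss_row k.+1] is the derivative of
   [gauss_monomial k]; up to the weight they are polynomials of exact degrees
   [0], [k.+1], so they may replace the monomials in a Vandermonde matrix. *)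
Definition row_poly k : {poly R} :=
  if k is k'.+1 then 'X^k'^`() - 'X^k else 1.

Definition gauss_row k (x : R) : R := (row_poly k).[x] * gauss_weight x.

Lemma gauss_row0 : gauss_row 0 = gauss_monomial 0.
Proof. by apply/funext => x; rewrite /gauss_row/= hornerC. Qed.

Lemma gauss_rowS k x : gauss_row k.+1 x =
  k%:R * gauss_monomial k.-1 x - gauss_monomial k.+1 x.
Proof.
rewrite /gauss_row /row_poly derivXn hornerD hornerN hornerMn !hornerXn.
by rewrite mulrBl -mulr_natl mulrA.
Qed.

Lemma size_row_poly k : (size (row_poly k) <= k.+1)%N.
Proof.
case: k => [|k]; first by rewrite size_poly1.
rewrite (leq_trans (size_polyD _ _))// geq_max size_polyN size_polyXn leqnn andbT.
by rewrite (leq_trans (ltnW (lt_size_deriv _)))// ?size_polyXn// monic_neq0 ?monicXn.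
Qed.

Lemma norm_coef_row_poly k : `|(row_poly k)`_k| = 1.
Proof.
case: k => [|k]; first by rewrite coef1 normr1.
rewrite coefB coef_deriv !coefXn eqxx gtn_eqF// mul0rn sub0r normrN normr1//.
Qed.

Lemma integrable_gauss_row k : leb.-integrable setT (EFin \o gauss_row k).
Proof.
case: k => [|k]; first by rewrite gauss_row0; exact: integrable_gauss_monomial.
rewrite (_ : _ \o _ = (fun x => k%:R%:E * (gauss_monomial k.-1 x)%:E) \-
    (EFin \o gauss_monomial k.+1))%E; last first.
  by apply/funext => x /=; rewrite gauss_rowS.
apply: integrableB => //; last exact: integrable_gauss_monomial.
by apply: integrableZl => //; exact: integrable_gauss_monomial.
Qed.

Lemma continuous_gauss_row k : continuous (gauss_row k).
Proof.
case: k => [|k]; first by rewrite gauss_row0; exact: continuous_gauss_monomial.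
rewrite (_ : gauss_row _ = fun x => k%:R * gauss_monomial k.-1 x - gauss_monomial k.+1 x).
  move=> x; apply: cvgB; last exact: continuous_gauss_monomial.
  by apply: cvgM; [exact: cvg_cst|exact: continuous_gauss_monomial].
by apply/funext => x; rewrite gauss_rowS.
Qed.

Lemma is_derive_gauss_monomial k (x : R) :
  is_derive x (1 : R) (gauss_monomial k) (gauss_row k.+1 x).
Proof.
have dw : is_derive x (1 : R) gauss_weight (- x * gauss_weight x).
  have -> : gauss_weight = expR \o (fun x : R => - (2^-1 * x ^+ 2)) by [].
  have dq : is_derive x (1 : R) (fun x : R => - (2^-1 * x ^+ 2)) (- x).
    by apply: is_derive_eq; rewrite /GRing.scale/=; field.
  apply: is_derive_eq; rewrite /GRing.scale/=; ring.
have dm : is_derive x (1 : R) (fun x : R => x ^+ k) (k%:R * x ^+ k.-1).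
  rewrite (_ : (fun _ => _) = id ^+ k); last by apply/funext => y; rewrite fctE.
  by apply: is_derive_eq; rewrite /GRing.scale/= mulr1.
have -> : gauss_monomial k = (fun x => x ^+ k) * gauss_weight by [].
rewrite gauss_rowS; apply: is_derive_eq; rewrite /GRing.scale/= /gauss_monomial exprS.
ring.
Qed.

Lemma Rintegral_gauss_row k b :
  \int[leb]_(x in `]-oo, b]) gauss_row k.+1 x = gauss_monomial k b.
Proof.
apply: Rintegral_FTCNy.
- exact: is_derive_gauss_monomial.
- exact: continuous_gauss_row.
- exact: integrable_gauss_row.
- have := @cvg_gauss_monomial k (- 1); rewrite normrN1.
  by under eq_fun do rewrite mulN1r; exact.
Qed.

Lemma Rintegral_gauss_rowT k : \int[leb]_x gauss_row k.+1 x = 0.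
Proof.
apply: (@Rintegral_FTCT _ _ (gauss_monomial k)).
- exact: is_derive_gauss_monomial.
- exact: continuous_gauss_row.
- exact: integrable_gauss_row.
- have := @cvg_gauss_monomial k 1; rewrite normr1.
  by under eq_fun do rewrite mul1r; exact.
- have := @cvg_gauss_monomial k (- 1); rewrite normrN1.
  by under eq_fun do rewrite mulN1r; exact.
Qed.

Lemma Rintegral_gauss_row0_gt0 : 0 < \int[leb]_x gauss_row 0 x.
Proof.
have pE x : gauss_row 0 x = (normal_peak 1)^-1 * normal_pdf 0 1 x.
  rewrite gauss_row0 /gauss_monomial expr0 mul1r normal_pdfE ?oner_neq0//.
  rewrite mulrA mulVf ?mul1r; last by rewrite gt_eqF// normal_peak_gt0 ?oner_neq0.
  by rewrite /normal_fun subr0 expr1n mulNr mulrC.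
under eq_Rintegral do rewrite pE.
rewrite RintegralZl//; last exact: integrable_normal_pdf.
rewrite /Rintegral integral_normal_pdf mulr1 invr_gt0.
by rewrite normal_peak_gt0// oner_neq0.
Qed.

End gaussian_monomials.

(** * Integrating out the odd-ranked eigenvalues *)

Section weights.
Context (R : realType).
Local Notation T := (measurableTypeR R).
Local Notation leb := (@lebesgue_measure R).

Lemma goe_weightE n (x : n.-tuple R) :
  goe_weight x = (\prod_(i < n) gauss_weight (tnth x i)) * vandermonde_abs x.
Proof.
rewrite /goe_weight -expR_sum; congr (expR _ * _).
by rewrite mulr_sumr sumrN.
Qed.

Lemma gse_weightE n (x : n.-tuple R) :
  gse_weight x = (\prod_(i < n) gauss_weight (tnth x i) ^+ 2) * vandermonde_abs x ^+ 4.
Proof.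
rewrite /gse_weight -sumrN expR_sum; congr (_ * _); apply: eq_bigr => i _.
by rewrite /gauss_weight -expRM_natl; congr expR; field.
Qed.

Definition row_matrix n (x : n.-tuple R) : 'M[R]_n :=
  \matrix_(i, k) gauss_row k (tnth x i).

Lemma det_row_matrix n (x : n.-tuple R) :
  \det (row_matrix x) = (\prod_(i < n) gauss_weight (tnth x i)) *
    ((\prod_(k < n) (row_poly R k)`_k) *
    \prod_(i < n) \prod_(j < n | (i < j)%N) (tnth x j - tnth x i)).
Proof.
rewrite -(det_poly_vandermonde (p := fun k => row_poly R k)); last first.
  by move=> k; exact: size_row_poly.
have -> : \prod_(i < n) gauss_weight (tnth x i) =
    \det (diag_mx (\row_i gauss_weight (tnth x i))).
  by rewrite det_diag; apply: eq_bigr => i _; rewrite mxE.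
rewrite -det_mulmx; congr determinant; rewrite mul_diag_mx; apply/matrixP => i k; rewrite !mxE.
by rewrite mulrC.
Qed.

Lemma norm_det_row_matrix n (x : n.-tuple R) : `|\det (row_matrix x)| = goe_weight x.
Proof.
rewrite det_row_matrix goe_weightE !normrM !normr_prod; congr (_ * _).
  by apply: eq_bigr => i _; rewrite ger0_norm// ltW// gauss_weight_gt0.
rewrite big1 ?mul1r; last by move=> k _; exact: norm_coef_row_poly.
apply: eq_bigr => i _; rewrite normr_prod; apply: eq_bigr => j _.
by rewrite distrC.
Qed.

(** Permuting the coordinates permutes the rows of the determinant and changes only its sign. *)
Lemma goe_weight_permt n (s : 'S_n) (x : n.-tuple R) :
  goe_weight (permt s x) = goe_weight x.
Proof.
rewrite -!norm_det_row_matrix.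
have -> : row_matrix (permt s x) = row_perm s (row_matrix x).
  by apply/matrixP => i k; rewrite !mxE tnth_mktuple.
by rewrite row_permE det_mulmx det_perm normrM normrX normrN1 expr1n mul1r.
Qed.

Lemma gse_weight_permt n (s : 'S_n) (x : n.-tuple R) :
  gse_weight (permt s x) = gse_weight x.
Proof.
(* This expresses the GSE weight through the GOE weight, already known to be symmetric, and a
   symmetric product. *)
have E (y : n.-tuple R) : gse_weight y =
      goe_weight y ^+ 4 / \prod_(i < n) gauss_weight (tnth y i) ^+ 2.
  rewrite gse_weightE goe_weightE exprMn.
  have P0 : \prod_(i < n) gauss_weight (tnth y i) != 0.
    by apply/prodf_neq0 => i _; rewrite gt_eqF// gauss_weight_gt0.
  by rewrite prodrXl; field.
rewrite !E goe_weight_permt; congr (_ / _).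
rewrite [RHS](reindex_inj (@perm_inj _ s))/=.
by apply: eq_bigr => i _; rewrite tnth_mktuple.
Qed.

Lemma vandermonde_abs_eq0 n (x : n.-tuple R) : ~~ uniq x -> vandermonde_abs x = 0.
Proof.
move=> /(uniqPn 0)[i [j [ij jn xij]]]; rewrite size_tuple in jn.
have iN := ltn_trans ij jn.
rewrite /vandermonde_abs (bigD1 (Ordinal iN))//= (bigD1 (Ordinal jn))//=.
by rewrite !(tnth_nth 0)/= xij subrr normr0 !mul0r.
Qed.

Lemma measurable_vandermonde_abs n :
  measurable_fun setT (fun x : n.-tuple T => vandermonde_abs x).
Proof.
rewrite /vandermonde_abs; apply: measurable_prod => j _.
under eq_fun do rewrite big_mkcond.
apply: measurable_prod => k _; case: (j < k)%N => //.
apply: measurableT_comp => //; apply: measurable_funB; exact: measurable_tnth.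
Qed.

Lemma measurable_gauss_weight_tnth n (i : 'I_n) :
  measurable_fun setT (fun x : n.-tuple T => gauss_weight (tnth x i)).
Proof.
apply: (measurableT_comp (f := @gauss_weight R)); last exact: measurable_tnth.
by apply: continuous_measurable_fun; exact: continuous_gauss_weight.
Qed.

Lemma measurable_goe_weight n :
  measurable_fun setT (fun x : n.-tuple T => goe_weight x).
Proof.
under eq_fun do rewrite goe_weightE.
apply: measurable_funM; last exact: measurable_vandermonde_abs.
by apply: measurable_prod => i _; exact: measurable_gauss_weight_tnth.
Qed.

Lemma measurable_gse_weight n :
  measurable_fun setT (fun x : n.-tuple T => gse_weight x).
Proof.
under eq_fun do rewrite gse_weightE.
apply: measurable_funM; last first.
  by apply: measurable_funX; exact: measurable_vandermonde_abs.
apply: measurable_prod => i _; apply: measurable_funX.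
exact: measurable_gauss_weight_tnth.
Qed.

Lemma goe_weight_ge0 n (x : n.-tuple R) : 0 <= goe_weight x.
Proof. by rewrite -norm_det_row_matrix. Qed.

Lemma gse_weight_ge0 n (x : n.-tuple R) : 0 <= gse_weight x.
Proof. by rewrite mulr_ge0 ?expR_ge0// exprn_even_ge0. Qed.

(** On a fixed chamber every difference of coordinates has constant sign, so the absolute value of
    the determinant opens up with one sign e for the whole chamber. The weight becomes multilinear
    in its rows there. *)
Lemma goe_weight_det n (p : 'S_n) : exists2 e : R, `|e| = 1 &
  forall x : n.-tuple R, decreasing (permt p x) ->
    goe_weight x = e * \det (row_matrix x).
Proof.
(* The sign of x_j - x_i on the chamber: negative exactly when i is listed before j in the
   decreasing order. *)
pose sg (i j : 'I_n) : R := (-1) ^+ ((p^-1)%g i < (p^-1)%g j)%N.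
pose C : R := \prod_(k < n) (row_poly R k)`_k.
pose e := \prod_(i < n) \prod_(j < n | (i < j)%N) sg i j.
have C1 : `|C| = 1.
  by rewrite normr_prod big1// => k _; exact: norm_coef_row_poly.
have e1 : `|e| = 1.
  rewrite normr_prod big1// => i _; rewrite normr_prod big1// => j _.
  by rewrite normrX normrN1 expr1n.
exists (e * C) => [|x xp]; first by rewrite normrM e1 C1 mulr1.
have sgE i j : i != j -> sg i j * (tnth x j - tnth x i) = `|tnth x i - tnth x j|.
  have xE k : tnth x k = tnth (permt p x) ((p^-1)%g k) by rewrite tnth_mktuple permKV.
  rewrite /sg !xE; case: ltngtP => [ij|ji|/val_inj/perm_inj ->]; last by rewrite eqxx.
    by rewrite expr1 mulN1r opprB ger0_norm// subr_ge0 ltW// xp.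
  by rewrite expr0 mul1r distrC ger0_norm// subr_ge0 ltW// xp.
have CC : C * C = 1 by rewrite -expr2 -real_normK ?num_real// C1 expr1n.
rewrite det_row_matrix goe_weightE.
have -> : vandermonde_abs x =
    e * \prod_(i < n) \prod_(j < n | (i < j)%N) (tnth x j - tnth x i).
  rewrite -big_split; apply: eq_bigr => i _; rewrite -big_split.
  by apply: eq_bigr => j ij; rewrite /= sgE// -val_eqE /= ltn_eqF.
set V := \prod_(i < n) \prod_(_ < _ | _) _.
set W := \prod_(i < n) _; rewrite -/C -[LHS]mul1r -CC; ring.
Qed.

End weights.

(** * Interleaved tuples and the gaps between the y_i *)

Section interleaving.
Context (R : realType) (n : nat).
Local Notation T := (measurableTypeR R).
Local Notation leb := (@lebesgue_measure R).

(* [shuffle y x] lists [x_0], then [y], then [x_1, ..., x_n]; the interleaved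
   list is [x_0, y_0, x_1, y_1, ..., y_(n-1), x_n]. *)
Definition interleave_index (k : nat) : nat :=
  if odd k then k./2.+1 else if k == 0%N then 0%N else (n + k./2)%N.

Lemma interleave_index_lt (k : 'I_(1 + (n + n))) :
  (interleave_index k < 1 + (n + n))%N.
Proof.
by rewrite /interleave_index; have := ltn_ord k; do !case: ifP => ?; lia.
Qed.

Definition interleave_ord (k : 'I_(1 + (n + n))) := Ordinal (interleave_index_lt k).

Lemma interleave_ord_inj : injective interleave_ord.
Proof.
move=> i j /(congr1 val); rewrite /= /interleave_index => ij; apply/val_inj => /=.
by move: ij; have := ltn_ord i; have := ltn_ord j; do !case: ifP => ?; lia.
Qed.

Definition interleave_perm := perm interleave_ord_inj.

Local Notation interleave y x := (permt interleave_perm (shuffle y x)).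

Lemma tnth_interleave (y : n.-tuple T) (x : n.+1.-tuple T) (k : 'I_(1 + (n + n))) :
  tnth (interleave y x) k = if odd k then nth 0 y k./2 else nth 0 x k./2.
Proof.
have kn := ltn_ord k.
rewrite tnth_mktuple permE; case: ifPn => [ko|ke].
  have kh : (k./2 < n)%N by lia.
  have -> : interleave_ord k = rshift 1 (lshift n (Ordinal kh)).
    by apply/val_inj; rewrite /= /interleave_index ko; lia.
  by rewrite tnth_shuffle1 (tnth_nth 0).
have [k0|k0] := eqVneq (k : nat) 0%N.
  have -> : interleave_ord k = lshift (n + n) ord0.
    by apply/val_inj; rewrite /= /interleave_index k0.
  by rewrite tnth_shuffle0 (tnth_nth 0) k0.
have kh : (k./2.-1 < n)%N by lia.
have -> : interleave_ord k = rshift 1 (rshift n (Ordinal kh)).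
  by apply/val_inj; rewrite /= /interleave_index (negPf ke) (negPf k0); lia.
rewrite tnth_shuffle2 (tnth_nth 0); congr (nth _ _ _).
by rewrite /= /bump; lia.
Qed.

Lemma decreasingP m (x : m.-tuple T) :
  decreasing x <-> forall k, (k.+1 < m)%N -> nth 0 x k.+1 < nth 0 x k.
Proof.
apply: (iff_trans (decreasing_sorted x)).
split=> [/(sortedP 0)|xD]; first by rewrite size_tuple.
by apply/(sortedP 0); rewrite size_tuple.
Qed.

Lemma nth_interleave (y : n.-tuple T) (x : n.+1.-tuple T) k : (k < 1 + (n + n))%N ->
  nth 0 (interleave y x) k = if odd k then nth 0 y k./2 else nth 0 x k./2.
Proof. by move=> kn; rewrite -(tnth_interleave y x (Ordinal kn)) (tnth_nth 0). Qed.

(** The entry x_(k+1) separates y_k from y_(k+1). *)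
Lemma decreasing_interleave_y (y : n.-tuple T) (x : n.+1.-tuple T) :
  decreasing (interleave y x) -> decreasing y.
Proof.
move=> /decreasingP yxD; apply/decreasingP => k kn.
have k1 : (k.*2.+2 < 1 + (n + n))%N by lia.
have k2 : (k.*2.+3 < 1 + (n + n))%N by lia.
apply: (@lt_trans _ _ (nth 0 x k.+1)).
  have := yxD _ k2; rewrite !nth_interleave ?(ltnW k2)//.
  by rewrite /= !negbK !odd_double /= !uphalf_double doubleK.
have := yxD _ k1; rewrite !nth_interleave ?(ltnW k1)//.
by rewrite /= !negbK !odd_double /= !uphalf_double doubleK.
Qed.

(** The gaps are (y_0, +oo), (y_1, y_0), ..., (-oo, y_(n-1)), open because the chamber is strict;
    for n = 0 the only gap is the whole line. *)
Definition lower_cut (y : n.-tuple T) (i : nat) : itv_bound R :=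
  if (i < n)%N then BRight (nth 0 y i) else -oo%O.

Definition gap (y : n.-tuple T) (i : nat) : interval R :=
  Interval (lower_cut y i) (if i is j.+1 then BLeft (nth 0 y j) else +oo%O).

(** The inequalities between neighbours are the two bounds on each x_i. Hence for fixed y the domain
    of x is a product of intervals. *)
Lemma decreasing_interleaveP (y : n.-tuple T) (x : n.+1.-tuple T) : 
  decreasing (interleave y x) <-> forall i : 'I_n.+1, tnth x i \in gap y i.
Proof.
apply: (iff_trans (decreasingP _)); split => [yxD i|xg k kn].
  rewrite (tnth_nth 0) itv_boundlr; apply/andP; split.
    rewrite /lower_cut; case: ifP => // iN.
    have kn : (i.*2.+1 < 1 + (n + n))%N by lia.
    have := yxD _ kn; rewrite !nth_interleave ?(ltnW kn)//=.
    by rewrite odd_double /= uphalf_double doubleK bnd_simp.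
  case: i => -[|j]//= jn.
  have kn : (j.*2.+2 < 1 + (n + n))%N by lia.
  have := yxD _ kn; rewrite !nth_interleave ?(ltnW kn)//=.
  by rewrite !negbK !odd_double /= uphalf_double doubleK bnd_simp.
rewrite !nth_interleave ?(ltnW kn)//=.
have kE := odd_double_half k; case: ifPn => ko.
  have kh : (k./2 < n.+1)%N by lia.
  have := xg (Ordinal kh); rewrite itv_boundlr => /andP[+ _].
  rewrite /lower_cut /= (tnth_nth 0) /=; case: ifPn => [_|]; last by lia.
  by rewrite (negPf ko) bnd_simp uphalf_half (negPf ko).
rewrite negbK in ko; rewrite ko.
have kh : (k./2.+1 < n.+1)%N by lia.
have := xg (Ordinal kh); rewrite itv_boundlr => /andP[_].
by rewrite /= (tnth_nth 0) /= bnd_simp uphalf_half ko.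
Qed.

End interleaving.

(** * The integral over x for fixed y *)

Section inner_integral.
Context (R : realType) (n : nat) (y : n.-tuple (measurableTypeR R)).
Local Notation T := (measurableTypeR R).
Local Notation leb := (@lebesgue_measure R).
Hypothesis y_decr : decreasing y.

Local Notation interleave x := (permt (interleave_perm n) (shuffle y x)).

Definition gap_integral (i k : nat) : R :=
  \int[leb]_(u in [set` gap y i]) gauss_row k u.

(** The value 0 at i = n corresponds to a cut at -oo and is the boundary condition of
    [det_telescope]. *)
Definition cut_integral (i k : nat) : R :=
  if (i < n)%N then \int[leb]_(u in `]-oo, nth 0 y i]) gauss_row k u else 0.

Let integrable_row (I : interval R) k :
  leb.-integrable [set` I] (EFin \o @gauss_row R k).
Proof.
apply: (@integrableS _ T R leb setT [set` I] _ measurableT _ (@subsetT _ _)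
  (integrable_gauss_row R k)).
exact: measurable_itv.
Qed.

Lemma gap_integral0 k :
  gap_integral 0 k = \int[leb]_u gauss_row k u - cut_integral 0 k.
Proof.
rewrite /gap_integral /gap /lower_cut /cut_integral; case: ifP => _.
  rewrite -(Rintegral_itvB (a := -oo%O)) ?set_itvNyy//.
  exact: integrable_gauss_row.
rewrite subr0; congr (Rintegral _ _ _); exact: set_itvNyy.
Qed.

Lemma gap_integralS i k : (i < n)%N ->
  gap_integral i.+1 k = cut_integral i k - cut_integral i.+1 k.
Proof.
move=> iN; rewrite /gap_integral /gap /lower_cut /cut_integral iN.
(* The gap is open at y_i while the cut integral includes that point, which has measure zero. *)
rewrite -Rintegral_itv_bndo_bndc; last exact: integrable_row.
case: ifP => iN1; last by rewrite subr0.
rewrite -(Rintegral_itvB (a := -oo%O))//.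
by rewrite bnd_simp; move/decreasingP: y_decr; exact.
Qed.

(** This is [row_matrix] of the shuffled tuple with the row of each x_i integrated over its gap. *)
Definition integrated_matrix : 'M[R]_(1 + (n + n)) :=
  col_mx (\row_k gap_integral 0 k)
    (col_mx (\matrix_(i < n, k < 1 + (n + n)) gauss_row k (tnth y i))
            (\matrix_(i < n, k < 1 + (n + n)) gap_integral i.+1 k)).

Lemma norm_det_integrated_matrix :
  `|\det integrated_matrix| = \int[leb]_u gauss_row 0 u * gse_weight y.
Proof.
pose c : R := \int[leb]_u gauss_row 0 u.
have c0 : 0 < c by exact: Rintegral_gauss_row0_gt0.
pose a := \col_(i < n) gauss_row 0 (tnth y i).
pose b := \col_(i < n) cut_integral i 0.
have := norm_det_interlacing (tnth y) (fun i => gauss_weight (tnth y i)) c a b.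
rewrite (ger0_norm (ltW c0)) -mulrA -gse_weightE => <-; congr (`|_|).
pose H (i : nat) (k : 'I_(1 + (n + n))) := cut_integral i k.
have Hn k : H n k = 0 by rewrite /H /cut_integral ltnn.
pose V := \matrix_(i < n, k < 1 + (n + n)) gauss_row k (tnth y i).
(* Undoing the telescoping turns gap integrals into cut integrals, and the first row into integrals
   over the whole line, which vanish outside column 0. *)
transitivity (\det (col_mx (row_mx c%:M 0 : 'rV[R]_(1 + (n + n)))
   (col_mx V (\matrix_(i < n, k < 1 + (n + n)) H i k)))).
  rewrite -(det_telescope _ _ Hn); congr (\det (col_mx _ (col_mx _ _))).
    apply/rowP => k; rewrite !mxE gap_integral0 /H; congr (_ - _).
    case: (splitP k) => k' kE; rewrite kE !mxE.
      by rewrite (ord1 k').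
    by rewrite add1n Rintegral_gauss_rowT.
  by apply/matrixP => i k; rewrite !mxE gap_integralS.
(* Column 0 supplies a and b. Column k + 1 holds (y^k w)' in the rows of y and its primitive y^k w
   in the cut rows. *)
congr (\det (col_mx _ (col_mx _ _))).
  apply/matrixP => i k; rewrite !mxE; case: (splitP k) => k' kE; rewrite kE !mxE.
    by rewrite (ord1 k').
  rewrite add1n gauss_rowS /gauss_monomial mulrBr -mulr_natl; ring.
apply/matrixP => i k; rewrite !mxE /H; case: (splitP k) => k' kE; rewrite kE !mxE.
  by rewrite (ord1 k').
rewrite add1n /cut_integral ltn_ord Rintegral_gauss_row (tnth_nth 0).
by rewrite /gauss_monomial mulrC.
Qed.

Definition x_row (i : 'I_n.+1) : 'I_(1 + (n + n)) :=
  if unlift ord0 i is Some k then rshift 1 (rshift n k) else lshift (n + n) ord0.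

Lemma x_row0 : x_row ord0 = lshift (n + n) ord0.
Proof. by rewrite /x_row unlift_none. Qed.

Lemma x_rowS k : x_row (lift ord0 k) = rshift 1 (rshift n k).
Proof. by rewrite /x_row liftK. Qed.

Lemma prod_shuffle_rows (F : 'I_(1 + (n + n)) -> R) :
  \prod_(i < 1 + (n + n)) F i =
  (\prod_(i < n) F (rshift 1 (lshift n i))) * \prod_(i < n.+1) F (x_row i).
Proof.
rewrite [X in _ = _ * X]big_ord_recl x_row0 big_split_ord big_ord1 big_split_ord.
rewrite /= mulrCA; congr (_ * (_ * _)).
by apply: eq_bigr => i _; rewrite x_rowS.
Qed.

(** On the chamber the weight is a sign times a determinant. Each Leibniz term is a product of
    functions of single x_i restricted to their gaps, so it integrates to a product, and these
    products reassemble into the determinant of [integrated_matrix]. *)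
Lemma integral_interleave :
  (\int[lebesgue_tuple R n.+1]_x
     (\1_(@decreasing R (1 + (n + n))) (interleave x) * goe_weight (shuffle y x))%:E =
   (\int[leb]_u gauss_row 0 u * gse_weight y)%R%:E)%E.
Proof.
have [e e1 eE] := goe_weight_det R (interleave_perm n).
pose g (s : 'S_(1 + (n + n))) (i : 'I_n.+1) :=
  (@gauss_row R (s (x_row i))) \_ [set` gap y i].
pose K (s : 'S_(1 + (n + n))) : R := e * ((-1) ^+ s *
  \prod_(i < n) gauss_row (s (rshift 1 (lshift n i))) (tnth y i)).
have ig s i : leb.-integrable setT (EFin \o g s i).
  rewrite /g -restrict_EFin; apply/integrable_restrict => //.
  by rewrite setTI; exact: integrable_row.
(* Off the chamber some x_i leaves its gap, and every product contains the corresponding zero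
   factor. *)
have fE x : \1_(@decreasing R (1 + (n + n))) (interleave x) * goe_weight (shuffle y x) =
    \sum_(s : 'S_(1 + (n + n))) K s * \prod_(i < n.+1) g s i (tnth x i).
  have [xD|xD] := pselect (decreasing (interleave x)).
    rewrite indicE mem_set// mul1r eE// /determinant mulr_sumr; apply: eq_bigr => s _.
    rewrite prod_shuffle_rows /K -!mulrA; congr (_ * (_ * (_ * _))).
      by apply: eq_bigr => i _; rewrite mxE tnth_shuffle1.
    apply: eq_bigr => i _; rewrite mxE /g patchE mem_set; last first.
      by move/decreasing_interleaveP : xD; exact.
    case: (unliftP ord0 i) => [k ->|->]; first by rewrite x_rowS tnth_shuffle2.
    by rewrite x_row0 tnth_shuffle0.
  rewrite indicE memNset// mul0r big1// => s _.
  have [i xi] : exists i, ~ tnth x i \in gap y i.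
    by apply/existsNP => xg; apply/xD/decreasing_interleaveP.
  by rewrite (bigD1 i)//= {1}/g patchE memNset// mul0r mulr0.
have I0 : (0 <= \int[lebesgue_tuple R n.+1]_x
    (\1_(@decreasing R (1 + (n + n))) (interleave x) * goe_weight (shuffle y x))%:E)%E.
  by apply: integral_ge0 => x _; rewrite lee_fin mulr_ge0// goe_weight_ge0.
have IE : (\int[lebesgue_tuple R n.+1]_x
    (\1_(@decreasing R (1 + (n + n))) (interleave x) * goe_weight (shuffle y x))%:E =
    (e * \det integrated_matrix)%:E)%E.
  under eq_integral do rewrite fE -sumEFin.
  rewrite integral_sum//; last first.
    move=> s; under eq_fun do rewrite EFinM.
    by apply: integrableZl => //; have [] := integral_prod_tuple (ig s).
  rewrite /determinant mulr_sumr -sumEFin; apply: eq_bigr => s _.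
  have [is_ Es] := integral_prod_tuple (ig s).
  under eq_integral do rewrite EFinM.
  rewrite integralZl// Es -EFinM prod_shuffle_rows /K -!mulrA; congr (_ * (_ * (_ * _)))%:E.
    by apply: eq_bigr => i _; rewrite !(col_mxEu, col_mxEd) mxE.
  apply: eq_bigr => i _; rewrite /g -Rintegral_mkcond.
  case: (unliftP ord0 i) => [k ->|->].
    by rewrite x_rowS !(col_mxEu, col_mxEd) mxE.
  by rewrite x_row0 !(col_mxEu, col_mxEd) mxE.
(* The integral is nonnegative and |e| = 1, so the sign disappears on taking absolute values. *)
rewrite IE -norm_det_integrated_matrix; congr EFin.
rewrite IE lee_fin in I0.
by rewrite -(ger0_norm I0) normrM e1 mul1r.
Qed.

End inner_integral.

(** * The exact identity between GOE of size 2n + 1 and GSE of size n *)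

Section finite_identity.
Context (R : realType).
Local Notation T := (measurableTypeR R).
Local Notation leb := (@lebesgue_measure R).
Local Notation interleave y x := (permt (interleave_perm _) (shuffle y x)).

Definition mth_largest_le n m (t : R) : set (n.-tuple T) :=
  [set x | mth_largest x m <= t].

Lemma mth_largest_permt n (s : 'S_n) (x : n.-tuple T) m :
  mth_largest (permt s x) m = mth_largest x m.
Proof.
rewrite /mth_largest; congr (nth _ _ _).
apply/perm_sortP; last exact: perm_permt.
- by move=> a b; exact: le_total.
- by move=> a b c ba ac; exact: le_trans ac ba.
- by move=> a b /andP[/= ba ab]; apply/eqP; rewrite eq_le ab ba.
Qed.

Lemma mth_largest_decreasing n (x : n.-tuple T) m : decreasing x ->
  mth_largest x m = nth 0 x m.-1.
Proof.
have x1 : permt 1%g x = x by apply: eq_from_tnth => i; rewrite tnth_mktuple perm1.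
by rewrite -{1}x1 => /sort_permt; rewrite x1 /mth_largest => ->.
Qed.

(** On each chamber the ranked entry is a coordinate, so the event splits into measurable pieces
    indexed by permutations. Ties escape this splitting, but f vanishes on them. *)
Lemma measurable_mth_largest_mul n m t (f : n.-tuple T -> R) :
  measurable_fun [set: n.-tuple T] f -> (forall x : n.-tuple T, ~~ uniq x -> f x = 0) ->
  measurable_fun setT (fun x => \1_(@mth_largest_le n m t) x * f x).
Proof.
move=> mf f0.
pose D := @decreasing R n `&` [set x | nth 0 x m.-1 <= t].
have mD : measurable D.
  apply: measurableI; first exact: measurable_decreasing.
  have mnth : measurable_fun setT (fun x : n.-tuple T => (nth 0 x m.-1 : R)).
    have [mn|nm] := ltnP m.-1 n.
      rewrite (_ : (fun _ => _) = (@tnth _ T)^~ (Ordinal mn)); first exact: measurable_tnth.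
      by apply/funext => x; rewrite (tnth_nth 0).
    rewrite (_ : (fun _ => _) = cst 0); first exact: measurable_cst.
    by apply/funext => x; rewrite nth_default// size_tuple.
  have := measurable_fun_ler mnth (measurable_cst t).
  by move=> /(_ measurableT [set true]); rewrite setTI; exact.
have mi : measurable_fun [set: n.-tuple T] (\1_D : _ -> R).
  by apply: measurable_indic.
rewrite (_ : (fun _ => _) = fun x => (\sum_(s : 'S_n) \1_D (permt s x)) * f x).
  apply: measurable_funM => //; apply: measurable_sum => s.
  exact: (measurableT_comp mi (measurable_permt s)).
apply/funext => x; have [xu|/f0 ->] := boolP (uniq x); last by rewrite !mulr0.
congr (_ * _); rewrite -[LHS]mulr1 -(sum_decreasing_permt xu) mulr_sumr.
apply: eq_bigr => s _; rewrite !indicE.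
have [xs|xs] := pselect (decreasing (permt s x)); last first.
  by rewrite [_ \in @decreasing _ _]memNset// mulr0 memNset// => -[].
rewrite [_ \in @decreasing _ _]mem_set// mulr1; congr (nat_of_bool _)%:R.
apply/idP/idP; rewrite !inE /mth_largest_le /D /=.
  by rewrite -(mth_largest_permt s) (mth_largest_decreasing _ xs).
by move=> [_]; rewrite -(mth_largest_permt s) (mth_largest_decreasing _ xs).
Qed.

Variable n : nat.

(** The factorials count the chambers on the two sides, and the Gaussian integral comes from the
    eliminated row. The last hypothesis says that on interlaced configurations the event [A] is seen
    by y alone, as [B]. *)
Lemma integral_goe_gse (A : set ((1 + (n + n)).-tuple T)) (B : set (n.-tuple T)) :
  (forall s z, A (permt s z) <-> A z) -> (forall s y, B (permt s y) <-> B y) ->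
  measurable_fun setT (fun z => \1_A z * goe_weight z) ->
  measurable_fun setT (fun y => \1_B y * gse_weight y) ->
  (forall y x, decreasing (interleave y x) -> A (shuffle y x) <-> B y) ->
  (\int[lebesgue_tuple R (1 + (n + n))]_(z in A) (goe_weight z)%:E =
   ((1 + (n + n))`!%:R * (\int[leb]_u gauss_row 0 u) / n`!%:R)%:E *
   \int[lebesgue_tuple R n]_(y in B) (gse_weight y)%:E)%E.
Proof.
move=> AS BS mA mB AB; set c : R := \int[leb]_u gauss_row 0 u.
have restrictE k (C : set (k.-tuple T)) (f : k.-tuple T -> R) :
    (\int[lebesgue_tuple R k]_(x in C) (f x)%:E =
     \int[lebesgue_tuple R k]_x (\1_C x * f x)%:E)%E.
  rewrite integral_mkcond; apply: eq_integral => x _; rewrite patchE indicE.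
  by case: ifP => _; rewrite ?mul1r ?mul0r.
have indS k (C : set (k.-tuple T)) : (forall s z, C (permt s z) <-> C z) ->
    forall s z, \1_C (permt s z) = \1_C z :> R.
  move=> CS s z; rewrite !indicE; congr (nat_of_bool _)%:R.
  by apply/idP/idP; rewrite !inE => /CS.
rewrite (restrictE _ A) (restrictE _ B).
(* With this reordering, the chamber in shuffled coordinates is the interlacing one. *)
rewrite (ge0_integral_symmetric (interleave_perm n) mA); first last.
- by move=> x /vandermonde_abs_eq0 v0; rewrite goe_weightE v0 !mulr0.
- by move=> s x; rewrite goe_weight_permt indS.
- by move=> x; rewrite mulr_ge0// goe_weight_ge0.
rewrite (ge0_integral_symmetric 1%g mB); first last.
- by move=> x /vandermonde_abs_eq0 v0; rewrite gse_weightE v0 expr0n/= !mulr0.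
- by move=> s x; rewrite gse_weight_permt indS.
- by move=> x; rewrite mulr_ge0// gse_weight_ge0.
rewrite muleA -EFinM divfK ?pnatr_eq0 -?lt0n ?fact_gt0// EFinM -muleA; congr (_ * _)%E.
have mD k p : measurable_fun setT (fun z : k.-tuple T => \1_(@decreasing R k) (permt p z) : R).
  have mi : measurable_fun [set: k.-tuple T] (\1_(@decreasing R k) : _ -> R).
    by apply: measurable_indic; exact: measurable_decreasing.
  exact: (measurableT_comp mi (measurable_permt p)).
rewrite ge0_integral_shuffle; first last.
- by move=> x; rewrite lee_fin mulr_ge0// mulr_ge0// goe_weight_ge0.
- by apply/measurable_EFinP; apply: measurable_funM => //; exact: mD.
have c0 : 0 <= c by exact/ltW/Rintegral_gauss_row0_gt0.
rewrite -ge0_integralZl//; first last.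
- by move=> x _; rewrite lee_fin mulr_ge0// mulr_ge0// gse_weight_ge0.
- by apply/measurable_EFinP; apply: measurable_funM => //; exact: mD.
apply: eq_integral => y _; rewrite -EFinM.
have y1 : permt 1%g y = y by apply: eq_from_tnth => i; rewrite tnth_mktuple perm1.
rewrite y1.
(* If y is not decreasing no x can interlace with it, and both sides are zero. *)
have [yD|yD] := pselect (decreasing y); last first.
  rewrite [\1__ y]indicE memNset// mul0r mulr0 integral0_eq// => x _.
  rewrite indicE memNset ?mul0r// => /decreasing_interleave_y.
  exact: yD.
rewrite [\1_(@decreasing _ _) y]indicE mem_set// mul1r.
rewrite (_ : c * _ = \1_B y * (c * gse_weight y)); last by ring.
rewrite EFinM -(integral_interleave yD) -ge0_integralZl//; first last.
- by move=> x _; rewrite lee_fin mulr_ge0// goe_weight_ge0.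
- have msh : measurable_fun setT (fun x : n.+1.-tuple T => shuffle y x).
    exact: (measurableT_comp (@measurable_shuffle R n) (pair1_measurable y)).
  apply/measurable_EFinP; apply: measurable_funM.
    exact: (measurableT_comp (mD _ _) msh).
  exact: (measurableT_comp (@measurable_goe_weight R _) msh).
apply: eq_integral => x _; rewrite -EFinM; congr EFin.
have [xyD|xyD] := pselect (decreasing (interleave y x)); last first.
  by rewrite ![\1_(@decreasing _ _) _]indicE memNset// !mul0r mulr0.
rewrite mulrCA; congr (_ * (_ * _)).
by rewrite !indicE; congr (nat_of_bool _)%:R; apply/idP/idP; rewrite !inE => /(AB _ _ xyD).
Qed.

(** The numerator and the normalising integral acquire the same positive constant [K], which cancels
    in the quotient. *)
Lemma goe_gse_prob m (t : R) : (0 < m <= n)%N ->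
  density_prob (@goe_weight R (1 + (n + n))) [set x | mth_largest x (2 * m) <= t] =
  density_prob (@gse_weight R n) [set y | mth_largest y m <= t].
Proof.
move=> /andP[m0 mn]; rewrite /density_prob.
set K := ((1 + (n + n))`!%:R * (\int[leb]_u gauss_row 0 u) / n`!%:R) : R.
have K0 : 0 < K by rewrite !mulr_gt0 ?invr_gt0 ?ltr0n ?fact_gt0// Rintegral_gauss_row0_gt0.
(* This covers infinite x too: [fine] is 0 there, and a positive factor keeps the value infinite. *)
have fineK0 x : fine (K%:E * x)%E = K * fine x.
  case: x => [r||] //=.
    by rewrite gt0_muley ?lte_fin//= mulr0.
  by rewrite gt0_muleNy ?lte_fin//= mulr0.
rewrite (@integral_goe_gse _ [set y | mth_largest y m <= t]); first last.
- move=> y x yxD /=.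
  rewrite -(mth_largest_permt (interleave_perm n)) (mth_largest_decreasing _ yxD).
  rewrite (mth_largest_decreasing _ (decreasing_interleave_y yxD)).
  (* Rank 2m sits at index 2m - 1, which is odd with half m - 1: it is the entry of rank m in y. The
     bound m <= n keeps the index in range. *)
  rewrite nth_interleave; last by lia.
  have -> : odd (2 * m).-1 by lia.
  by have -> : (2 * m).-1./2 = m.-1 by lia.
- apply: measurable_mth_largest_mul; first exact: measurable_gse_weight.
  by move=> x /vandermonde_abs_eq0 v0; rewrite gse_weightE v0 expr0n/= mulr0.
- apply: measurable_mth_largest_mul; first exact: measurable_goe_weight.
  by move=> x /vandermonde_abs_eq0 v0; rewrite goe_weightE v0 mulr0.
- by move=> s y /=; rewrite mth_largest_permt.
- by move=> s z /=; rewrite mth_largest_permt.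
rewrite (@integral_goe_gse setT setT)//; first last.
- apply: measurable_funM; last exact: measurable_gse_weight.
  exact: measurable_indic.
- apply: measurable_funM; last exact: measurable_goe_weight.
  exact: measurable_indic.
by rewrite -/K !fineK0 -mulf_div divff ?mul1r// gt_eqF.
Qed.

End finite_identity.

(** * Passage to the limit along the sizes N = 2n + 1 *)

Theorem corollary1p2p2 (R : realType) (F1 F4 : R -> nat -> R)
    (hF1 : is_F1 F1) (hF4 : is_F4 F4) (s : R) (m : nat) (hm : (1 <= m)%N) :
  F4 s m = F1 s (2 * m)%N.
Proof.
apply: (cvg_unique (@Rhausdorff R) (hF4 s m hm)).
have m2 : (0 < 2 * m)%N by rewrite muln_gt0.
have N_oo : (n.*2.+1)%N @[n --> \oo] --> \oo.
  apply/cvgnyPge => A; near=> n; rewrite ltnW// ltnS -addnn.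
  rewrite (leq_trans _ (leq_addr _ _))//; near: n; exact: nbhs_infty_ge.
have cF1 : goe_edge_prob s (2 * m) n.*2.+1 @[n --> \oo] --> F1 s (2 * m)%N.
  exact: (cvg_comp (fun n => n.*2.+1) (goe_edge_prob s (2 * m)) N_oo (hF1 s _ m2)).
apply: cvg_trans cF1.
(* The finite identity requires m <= n, hence holds for all large n; the two edges agree since the
   GSE one is defined with N = 2n + 1. *)
apply: near_eq_cvg; near=> n.
have mn : (m <= n)%N by near: n; exact: nbhs_infty_ge.
rewrite /goe_edge_prob /gse_edge_prob /= -addnn -add1n goe_gse_prob ?hm//.
Unshelve. all: by end_near. Qed.
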